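(* There exists a polynomial $\alpha_{av}\in\mathbb{N}[t]$ such that for every $m\in C^\infty(G)$ with compact support modulo $Z(G)$, every $x\in G^{rss}$ and every $i\in\mathbb{N}$, $$|\mathcal{A}_i(m)(x)|\le \alpha_{av}\big(i+ov_{G^{rss}}(x)\big)\,\Omega(|m|)(x).$$
   Context: $F$ is a non-Archimedean local field of arbitrary characteristic, $O_F$ its ring of integers, $\mathrm{val}$ the normalized valuation. $G=\mathrm{GL}_n(F)$, $Z(G)$ its center, $G^{ad}=G/Z(G)$. For $x\in G$, $ov_G(x)=\max\big(\max_{i,j}(-\mathrm{val}(x_{ij})),\mathrm{val}(\det x)\big)$, $G_i=\{x: ov_G(x)\le i\}$, $(G^{ad})_i$ its image in $G^{ad}$. $\Delta(x)$ is the discriminant of the characteristic polynomial, $G^{rss}=\{\Delta\ne0\}$, $ov_{G^{rss}}(x)=\max(ov_G(x),\mathrm{val}\Delta(x))$. Measures: $\mu_G$ Haar on $G$ with $\mu_G(\mathrm{GL}_n(O_F))=1$; $\mu_{Z(G)}$ Haar on $Z(G)\cong F^\times$ with $O_F^\times$ of measure 1; $\mu_{G^{ad}}$ the quotient measure. For $x\in G^{rss}$, $\mu_{G_x}$ is the Haar measure on the centralizer torus $G_x$ giving its maximal compact subgroup measure 1, and $\mu_{G\cdot x}$ the invariant measure on $G\cdot x\cong G/G_x$ corresponding to $\mu_G,\mu_{G_x}$. For $f$ smooth and compactly supported mod center, $\Omega(f)(x)=\int_{G\cdot x}f\,d\mu_{G\cdot x}$, and $\mathcal{A}_i(f)(x)=\int_{(G^{ad})_i}f(gxg^{-1})\,d\mu_{G^{ad}}(g)$.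 *)

(* Defs.v *)
From HB Require Import structures.
From mathcomp Require Import all_boot all_order all_algebra.
From mathcomp Require Import all_classical all_reals all_analysis.
Set Implicit Arguments. Unset Strict Implicit. Unset Printing Implicit Defensive.
Import Order.TTheory GRing.Theory Num.Theory.
Import numFieldNormedType.Exports.
Local Open Scope classical_set_scope.
Local Open Scope ring_scope.

(* Non-Archimedean local fields: a field F with a normalized discrete       *)
(* valuation val : F -> int (the value val 0 is junk; "val x >= k" is read  *)
(* through [vge], with the convention val 0 = +oo), finite residue field,   *)
(* complete.                                                                *)

Definition vge (F : fieldType) (val : F -> int) (x : F) (k : int) : bool :=
  (x == 0) || (k <= val x).

Record nonarch_local_field (F : fieldType) (val : F -> int) : Prop := {
  nlf_valM : forall x y : F, x != 0 -> y != 0 -> val (x * y) = val x + val y;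
  nlf_valD : forall x y : F, x != 0 -> y != 0 ->
      vge val (x + y) (Num.min (val x) (val y));
  nlf_unif : exists pi : F, pi != 0 /\ val pi = 1;
  (* finite residue field: O_F is covered by finitely many classes mod m_F *)
  nlf_resfin : exists s : seq F, forall x : F, vge val x 0 ->
      exists2 y, y \in s & vge val (x - y) 1;
  nlf_complete : forall u : nat -> F,
      (forall k : int, exists N : nat, forall p q : nat, (N <= p)%N -> (N <= q)%N ->
          vge val (u p - u q) k) ->
      exists l : F, forall k : int, exists N : nat, forall p : nat, (N <= p)%N ->
          vge val (u p - l) k
}.

(* G = GL_n(F) inside the matrix space 'M[F]_n, with its Borel sigma-algebra *)
(* (generated by the balls  g + pi^k M_n(O_F) ).                            *)

(* matrices, as a pointed type (needed for the generated sigma-algebra) *)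
Definition Mat (F : fieldType) (n : nat) := 'M[F]_n.
HB.instance Definition _ F n := Choice.on (Mat F n).
HB.instance Definition _ F n := isPointed.Build (Mat F n) 0%R.

Definition mball (F : fieldType) (val : F -> int) (n : nat) (g : 'M[F]_n) (k : int)
  : set 'M[F]_n := [set h | forall i j, vge val (h i j - g i j) k].

Definition mballs (F : fieldType) (val : F -> int) (n : nat) : set (set (Mat F n)) :=
  [set B | exists (g : 'M[F]_n) (k : int), B = mball val g k].

Notation MT val n := (g_sigma_algebraType (@mballs _ val n)).

Arguments mballs F val n : clear implicits.

Definition GL (F : fieldType) (n : nat) : set 'M[F]_n := [set g : 'M[F]_n | g \in unitmx].

Definition GLO (F : fieldType) (val : F -> int) (n : nat) : set 'M[F]_n :=
  [set g : 'M[F]_n | (forall i j, vge val (g i j) 0) /\ \det g != 0 /\ val (\det g) = 0].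

(* ov_G(x) = max( max_{i,j} (-val x_ij), val (det x) ), entries x_ij = 0     *)
(* (val = +oo, so -val = -oo) being omitted from the max.                   *)
Definition ovG (F : fieldType) (val : F -> int) (n : nat) (x : 'M[F]_n) : int :=
  \big[Num.max/val (\det x)]_(ij : 'I_n * 'I_n | x ij.1 ij.2 != 0) (- val (x ij.1 ij.2)).

Definition Gi (F : fieldType) (val : F -> int) (n : nat) (i : nat) : set 'M[F]_n :=
  [set g : 'M[F]_n | g \in unitmx /\ ovG val g <= i%:Z].

Definition Zset (F : fieldType) (n : nat) : set 'M[F]_n :=
  [set g : 'M[F]_n | exists c : F, c != 0 /\ g = c%:M].
Definition ZO (F : fieldType) (val : F -> int) (n : nat) : set 'M[F]_n :=
  [set g : 'M[F]_n | exists c : F, c != 0 /\ val c = 0 /\ g = c%:M].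

(* preimage in G of (G^ad)_i = image of G_i in G^ad, i.e. Z(G).G_i *)
Definition ZGi (F : fieldType) (val : F -> int) (n : nat) (i : nat) : set 'M[F]_n :=
  [set g : 'M[F]_n | g \in unitmx /\ exists c : F, c != 0 /\ @Gi F val n i (c *: g)].

(* discriminant of the characteristic polynomial; Delta(x) =                *)
(* (-1)^(n(n-1)/2) Res(chi_x, chi_x')  (chi_x monic of degree n)            *)
Definition Delta (F : fieldType) (n : nat) (x : 'M[F]_n) : F :=
  (-1) ^+ (n * n.-1)./2 * resultant (char_poly x) (char_poly x)^`().

Definition Grss (F : fieldType) (n : nat) : set 'M[F]_n :=
  [set x : 'M[F]_n | x \in unitmx /\ Delta x != 0].
Definition ovGrss (F : fieldType) (val : F -> int) (n : nat) (x : 'M[F]_n) : int :=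
  Num.max (ovG val x) (val (Delta x)).

Arguments GL F n : clear implicits.
Arguments GLO F val n : clear implicits.
Arguments ZO F val n : clear implicits.
Arguments Gi F val n i : clear implicits.
Arguments ZGi F val n i : clear implicits.
Arguments Zset F n : clear implicits.
Arguments Grss F n : clear implicits.

Definition centralizer (F : fieldType) (n : nat) (x : 'M[F]_n) : set 'M[F]_n :=
  [set g : 'M[F]_n | g \in unitmx /\ g *m x = x *m g].

(* maximal compact subgroup of an abelian closed subgroup H of G: the       *)
(* elements h of H generating a bounded (= relatively compact) subgroup     *)
Definition mpow (F : fieldType) (n : nat) (h : 'M[F]_n) (k : nat) : 'M[F]_n :=
  iter k (mulmx h) 1%:M.
Definition maxcpt (F : fieldType) (val : F -> int) (n : nat) (H : set 'M[F]_n)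
  : set 'M[F]_n :=
  [set h : 'M[F]_n | H h /\ exists C : int, forall k : nat,
      ovG val (mpow h k) <= C /\ ovG val (mpow (invmx h) k) <= C].

(* nu is a left Haar measure on the closed subgroup H of G (viewed as a     *)
(* Borel measure on the matrix space concentrated on H), normalized by      *)
(* nu K = 1.                                                                *)
Definition haar_on (R : realType) (F : fieldType) (val : F -> int) (n : nat)
  (H K : set (MT val n)) (nu : {measure set (MT val n) -> \bar R}) : Prop :=
  [/\ nu (~` H) = 0%E,
      (forall (h : MT val n) (A : set (MT val n)), H h -> measurable A -> A `<=` H ->
          nu [set (h *m a : MT val n) | a in A] = nu A)
    & nu K = 1%E].

(* w is a Bruhat-type weight for G -> G/H w.r.t. the Haar measure nu on H:  *)
(* int_H w(gh) dnu(h) = 1 for all g in G.  For a right-H-invariant psi,     *)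
(* the integral of psi over G/H (quotient measure of mu_G and nu) is then   *)
(* int_G psi(g) w(g) dmu_G(g)  (Weil's integration formula).                *)
Definition qweight (R : realType) (F : fieldType) (val : F -> int) (n : nat)
  (H : set (MT val n)) (nu : {measure set (MT val n) -> \bar R})
  (w : MT val n -> R) : Prop :=
  [/\ forall g, 0 <= w g, measurable_fun setT w
    & forall g : MT val n, g \in unitmx ->
        (\int[nu]_(h in H) (w (g *m h : MT val n))%:E = 1)%E].

Definition conj (F : fieldType) (n : nat) (g x : 'M[F]_n) : 'M[F]_n :=
  g *m x *m invmx g.

(* Test functions: m = mr + i mi, locally constant on G, with support       *)
(* compact modulo Z(G) (i.e. contained in Z(G).G_k for some k).             *)
Definition smooth_cpt_mod_center (R : realType) (F : fieldType) (val : F -> int)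
  (n : nat) (mr mi : 'M[F]_n -> R) : Prop :=
  (forall g, g \in unitmx -> exists k : int, forall h, mball val g k h ->
       mr h = mr g /\ mi h = mi g) /\
  (exists k : nat, forall g, g \in unitmx -> (mr g != 0 \/ mi g != 0) -> @ZGi F val n k g).

(* A_i(m)(x) = int_{(G^ad)_i} m(g x g^-1) dmu_{G^ad}(g), computed as the    *)
(* pair (real part, imaginary part), with the quotient measure expressed    *)
(* through a weight wZ for G -> G/Z(G).                                     *)
Definition Avg (R : realType) (F : fieldType) (val : F -> int) (n : nat)
  (mu : {measure set (MT val n) -> \bar R}) (wZ : MT val n -> R)
  (mr mi : 'M[F]_n -> R) (i : nat) (x : 'M[F]_n) : R * R :=
  (\int[mu]_(g in (@ZGi F val n i : set (MT val n))) (mr (conj g x) * wZ g),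
   \int[mu]_(g in (@ZGi F val n i : set (MT val n))) (mi (conj g x) * wZ g)).

(* Omega(|m|)(x) = int_{G.x} |m| dmu_{G.x} = int_{G/G_x} |m|(g x g^-1),      *)
(* quotient measure expressed through a weight wx for G -> G/G_x.           *)
Definition Orb (R : realType) (F : fieldType) (val : F -> int) (n : nat)
  (mu : {measure set (MT val n) -> \bar R}) (wx : MT val n -> R)
  (f : 'M[F]_n -> R) (x : 'M[F]_n) : \bar R :=
  (\int[mu]_(g in (GL F n : set (MT val n))) (f (conj g x) * wx g)%:E)%E.

Definition cnorm (R : realType) (z : R * R) : R := Num.sqrt (z.1 ^+ 2 + z.2 ^+ 2).

(* Main.v *)
(* Write T for the centralizer of x and T0 for its maximal compact subgroup.
   Unfolding over G/T (Tonelli, the weight wx and the unimodularity of G), the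
   average of |m| over (G^ad)_i is at most the orbital integral times the
   supremum over g of the mass in T/Z of {t : g t^-1 \in Z G_i}.  Translating by
   a point of this set, the mass is bounded by the number of cosets of Z T0
   meeting T :&: G_j with j = (n + 1) i.

   To count these cosets, let E = F[x] be the commutant of x, write 1 as a sum
   of at most n primitive idempotents e of E, and put
   v_e(t) = val (det (t e + 1 - e)).  Each e E is a field, so by compactness of
   its unit sphere {t : v_e(t) >= 0} has bounded image in e E; hence t lies in
   T0 as soon as all v_e(t) vanish.  Comparing t^k with k v_e(t) for large k
   bounds v_e(t) on G_j between -n j and n^2 j, independently of x, and the
   number of cosets is at most (n^2 j + n j + 1)^n.

   Unimodularity: the right modulus is a positive character of G that is trivial
   on GL_n(O_F) and on the center; triangular unipotent matrices are conjugate
   into GL_n(O_F), and the product of the cyclic conjugates of a diagonal matrix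
   is scalar, so it is trivial by the LUP decomposition. *)
Require Import Defs.
From HB Require Import structures.
From mathcomp Require Import all_boot all_order all_algebra.
From mathcomp Require Import perm separable.
From mathcomp Require Import all_classical all_reals all_analysis.
From mathcomp Require Import measurable_realfun.
From mathcomp Require Import zify ring.
Import Order.TTheory GRing.Theory Num.Theory.
Set Implicit Arguments. Unset Strict Implicit. Unset Printing Implicit Defensive.
Local Open Scope classical_set_scope.
Local Open Scope ring_scope.

(** * Valuations of scalars and matrices *)

(** The bound must be polynomial in [i] with coefficients free of [x], whereas compactness in the
    torus yields constants that depend on [x] through its idempotents. Such constants are therefore
    used only qualitatively, to place an element in the maximal compact subgroup, and never enter a
    count. The numerical bounds come from determinants of powers [t ^+ k]: the fixed cost of an
    idempotent is divided by [k], and since valuations are integers it disappears once [k] exceeds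
    it. Arbitrary characteristic is handled through [Delta x != 0], that is, the characteristic
    polynomial is coprime to its derivative. This gives both commutativity of the commutant and a
    squarefree minimal polynomial, with no eigenvalues or field extensions. Quotient measures appear
    only through weights, and the changes of variables in the torus and the center are left
    translations; right invariance is called upon for [G] alone. *)

Section Valuation.
Variables (F : fieldType) (val : F -> int).
Hypothesis hF : nonarch_local_field val.

Local Notation vge := (vge val).

Lemma nval1 : val 1 = 0.
Proof.
have := nlf_valM hF (oner_neq0 F) (oner_neq0 F).
by rewrite mulr1; set v := val 1 => h; lia.
Qed.

Lemma nvalN1 : val (-1) = 0.
Proof.
have n1 : (-1 : F) != 0 by rewrite oppr_eq0 oner_eq0.
have := nlf_valM hF n1 n1.
by rewrite mulrNN mulr1 nval1; set v := val (-1) => h; lia.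
Qed.

Lemma valV x : x != 0 -> val x^-1 = - val x.
Proof.
move=> x0; have := nlf_valM hF x0 (invr_neq0 x0).
by rewrite divff// nval1 => h; lia.
Qed.

Lemma valX x k : x != 0 -> val (x ^+ k) = val x *+ k.
Proof.
move=> x0; elim: k => [|k IH]; first by rewrite expr0 mulr0n nval1.
by rewrite exprS mulrS (nlf_valM hF) ?expf_neq0// IH.
Qed.

Lemma vge0 k : vge 0 k. Proof. by rewrite /Defs.vge eqxx. Qed.

Lemma vge_val x k : x != 0 -> vge x k = (k <= val x).
Proof. by rewrite /Defs.vge => /negPf ->. Qed.

Lemma vge_le x k l : l <= k -> vge x k -> vge x l.
Proof.
move=> lk /orP[/eqP ->|h]; first exact: vge0.
by rewrite /Defs.vge (le_trans lk h) orbT.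
Qed.

Lemma vgeD x y k : vge x k -> vge y k -> vge (x + y) k.
Proof.
have [->|x0] := eqVneq x 0; first by rewrite add0r.
have [->|y0] := eqVneq y 0; first by rewrite addr0.
rewrite (vge_val _ x0) (vge_val _ y0) => hx hy; apply: vge_le (nlf_valD hF x0 y0).
by rewrite le_min hx.
Qed.

Lemma vgeM x y k l : vge x k -> vge y l -> vge (x * y) (k + l).
Proof.
have [->|x0] := eqVneq x 0; first by move=> *; rewrite mul0r vge0.
have [->|y0] := eqVneq y 0; first by move=> *; rewrite mulr0 vge0.
rewrite !vge_val ?mulf_neq0// (nlf_valM hF)//; exact: lerD.
Qed.

Lemma vge1 : vge 1 0.
Proof. by rewrite vge_val ?oner_eq0// nval1. Qed.

Lemma vgeN x k : vge (- x) k = vge x k.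
Proof.
have H y : vge y k -> vge (- y) k.
  move=> h; rewrite -mulN1r -[k]add0r; apply: vgeM => //.
  by rewrite vge_val ?oppr_eq0 ?oner_eq0// nvalN1.
by apply/idP/idP => [/H|/H//]; rewrite opprK.
Qed.

Lemma vgeB x y k : vge x k -> vge y k -> vge (x - y) k.
Proof. by move=> hx hy; apply: vgeD => //; rewrite vgeN. Qed.

Lemma vge_sum (I : Type) (r : seq I) (P : pred I) (f : I -> F) k :
  (forall i, P i -> vge (f i) k) -> vge (\sum_(i <- r | P i) f i) k.
Proof.
move=> h; elim/big_ind: _ => //; first exact: vge0.
by move=> ? ?; exact: vgeD.
Qed.

Lemma vge_prod (I : finType) (f : I -> F) k :
  (forall i, vge (f i) k) -> vge (\prod_i f i) (k *+ #|I|).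
Proof.
move=> h; rewrite cardE -big_enum /=; elim: (enum I) => [|i s IH].
  by rewrite big_nil mulr0n vge1.
by rewrite big_cons /= mulrS; apply: vgeM.
Qed.

Lemma vgeX x k m : vge x k -> vge (x ^+ m) (k *+ m).
Proof.
move=> h; elim: m => [|m IH]; first by rewrite expr0 mulr0n vge1.
by rewrite exprS mulrS; apply: vgeM.
Qed.

(** Ultrametric rigidity: a perturbation strictly smaller than [x] cannot affect its valuation. It
    serves to show that matrices congruent to 1 have unit determinant. *)
Lemma val_near x y : x != 0 -> vge (y - x) (val x + 1) -> y != 0 /\ val y = val x.
Proof.
move=> x0 h; have yE : y = x + (y - x) by rewrite addrC subrK.
have y0 : y != 0.
  apply/eqP => y0; move: h; rewrite y0 sub0r vgeN vge_val// => h.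
  by lia.
split=> //; apply/eqP; rewrite eq_le; apply/andP; split.
- rewrite leNgt; apply/negP => hlt.
  have : vge x (val x + 1).
    have xE : x = y - (y - x) by rewrite opprB addrC subrK.
    rewrite [X in vge X _]xE; apply: vgeB => //.
    by rewrite vge_val//; lia.
  by rewrite vge_val// => ?; lia.
- rewrite -vge_val// [X in vge X _]yE; apply: vgeD; first by rewrite vge_val.
  by apply: vge_le h; lia.
Qed.

Lemma vge_all x : (forall k : nat, vge x k%:Z) -> x = 0.
Proof.
move=> h; apply/eqP; apply/negPn/negP => x0.
have := h (`|val x|.+1)%N; rewrite vge_val//; lia.
Qed.

Section Matrices.
Variable n : nat.
Implicit Types (A B : 'M[F]_n).

Definition mvge (A : 'M[F]_n) (k : int) := forall i j, vge (A i j) k.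

Lemma mballE A k B : mball val A k B <-> mvge (B - A) k.
Proof. by split=> h i j; have := h i j; rewrite !mxE. Qed.

Lemma mvge0 k : mvge 0 k. Proof. by move=> i j; rewrite mxE vge0. Qed.
Lemma mvge_le A k l : l <= k -> mvge A k -> mvge A l.
Proof. by move=> lk h i j; apply: vge_le (h i j). Qed.
Lemma mvgeD A B k : mvge A k -> mvge B k -> mvge (A + B) k.
Proof. by move=> hA hB i j; rewrite mxE; apply: vgeD. Qed.
Lemma mvgeN A k : mvge A k -> mvge (- A) k.
Proof. by move=> hA i j; rewrite mxE vgeN. Qed.
Lemma mvgeB A B k : mvge A k -> mvge B k -> mvge (A - B) k.
Proof. by move=> hA hB; apply: mvgeD => //; apply: mvgeN. Qed.
Lemma mvge_sum (I : Type) (r : seq I) (P : pred I) (f : I -> 'M[F]_n) k :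
  (forall i, P i -> mvge (f i) k) -> mvge (\sum_(i <- r | P i) f i) k.
Proof.
move=> h; elim/big_ind: _ => //; first exact: mvge0.
by move=> ? ?; exact: mvgeD.
Qed.
Lemma mvge_seq_sum (s : seq 'M[F]_n) (f : 'M[F]_n -> 'M[F]_n) k :
  (forall e, e \in s -> mvge (f e) k) -> mvge (\sum_(e <- s) f e) k.
Proof. by move=> h; rewrite big_seq; exact: mvge_sum. Qed.
Lemma mvgeM A B k l : mvge A k -> mvge B l -> mvge (A *m B) (k + l).
Proof. by move=> hA hB i j; rewrite mxE; apply: vge_sum => p _; apply: vgeM. Qed.
Lemma mvgeZ c A k l : vge c k -> mvge A l -> mvge (c *: A) (k + l).
Proof. by move=> hc hA i j; rewrite mxE; apply: vgeM. Qed.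
Lemma mvge1 : mvge 1%:M 0.
Proof. by move=> i j; rewrite mxE; case: eqP => _; rewrite ?vge0 ?vge1. Qed.

Lemma mvge_all A : (forall k : nat, mvge A k%:Z) -> A = 0.
Proof. by move=> h; apply/matrixP => i j; rewrite mxE; apply: vge_all => k; apply: h. Qed.

Lemma mvge_exists A : exists k : nat, mvge A (- k%:Z).
Proof.
(* The junk value [val 0] can only enlarge the maximum, since [vge] accepts zero entries
   outright. *)
exists (\max_(ij : 'I_n * 'I_n) `|val (A ij.1 ij.2)|)%N => i j.
have := leq_bigmax (F := fun ij : 'I_n * 'I_n => `|val (A ij.1 ij.2)|%N) (i, j).
rewrite /= /Defs.vge; set M := bigop _ _ _ => h.
by apply/orP; right; lia.
Qed.

Lemma mpowS A k : mpow A k.+1 = A *m mpow A k. Proof. by []. Qed.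

End Matrices.

Lemma vge_det n (A : 'M[F]_n) k : mvge A k -> vge (\det A) (k *+ n).
Proof.
move=> hA; apply: vge_sum => s _; rewrite -[k *+ n]add0r; apply: vgeM.
  have h : vge (-1) 0 by rewrite vgeN vge1.
  by have := vgeX (s : bool) h; rewrite mul0rn.
by have := @vge_prod 'I_n (fun i => A i (s i)) k; rewrite card_ord; apply.
Qed.

Lemma vge_prod_cong (I : Type) (r : seq I) (f g : I -> F) (k : int) : 0 <= k ->
  (forall i, vge (f i) 0) -> (forall i, vge (g i) 0) ->
  (forall i, vge (f i - g i) k) ->
  [/\ vge (\prod_(i <- r) f i) 0, vge (\prod_(i <- r) g i) 0
    & vge (\prod_(i <- r) f i - \prod_(i <- r) g i) k].
Proof.
move=> k0 hf hg h; elim: r => [|i r [IH1 IH2 IH3]].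
  by rewrite !big_nil subrr vge0 vge1.
rewrite !big_cons; split.
- by rewrite -[0 : int]addr0; apply: vgeM.
- by rewrite -[0 : int]addr0; apply: vgeM.
- set P := \prod_(j <- r) f j in IH1 IH3 *; set Q := \prod_(j <- r) g j in IH2 IH3 *.
  have -> : f i * P - g i * Q = (f i - g i) * P + g i * (P - Q) by ring.
  apply: vgeD; first by rewrite -[k]addr0; apply: vgeM.
  by rewrite -[k]add0r; apply: vgeM.
Qed.

Lemma vge_det_cong n (A B : 'M[F]_n) k : 0 <= k -> mvge A 0 -> mvge B 0 ->
  mvge (A - B) k -> vge (\det A - \det B) k.
Proof.
move=> k0 hA hB hAB; rewrite /determinant -sumrB; apply: vge_sum => s _.
rewrite -mulrBr -[k]add0r; apply: vgeM.
  have h : vge (-1) 0 by rewrite vgeN vge1.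
  by have := vgeX (s : bool) h; rewrite mul0rn.
have hd i : vge (A i (s i) - B i (s i)) k by have := hAB i (s i); rewrite !mxE.
by have [] := @vge_prod_cong _ (index_enum 'I_n) (fun i => A i (s i)) (fun i => B i (s i)) k k0
  (fun i => hA _ _) (fun i => hB _ _) hd.
Qed.

Lemma mvge_adj n (A : 'M[F]_n) (k : int) : mvge A k -> mvge (\adj A) (k *+ n.-1).
Proof.
move=> hA i j; rewrite mxE /cofactor -[_ *+ _]add0r; apply: vgeM.
  have h : vge (-1) 0 by rewrite vgeN vge1.
  by have := vgeX (j + i) h; rewrite mul0rn.
by apply: vge_det => p q; rewrite !mxE.
Qed.

(** * [GL_n(O_F)], its congruence subgroups and the filtration [Gi] *)

Section Groups.
Variable n : nat.
Implicit Types (A B g h : 'M[F]_n).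
Local Notation K := (GLO F val n).

Lemma unitmx_det0 g : (g \in unitmx) = (\det g != 0).
Proof. by rewrite unitmxE unitfE. Qed.

Lemma GLO_unit g : K g -> g \in unitmx.
Proof. by case=> _ [h _]; rewrite unitmx_det0. Qed.

Lemma invmx_mul g h : g \in unitmx -> h \in unitmx ->
  invmx (g *m h) = invmx h *m invmx g.
Proof.
move=> gu hu; have ghu : g *m h \in unitmx by rewrite unitmx_mul gu.
have E : invmx h *m invmx g *m (g *m h) = 1%:M by rewrite -mulmxA mulKmx// mulVmx.
by rewrite -[RHS](mulmxK ghu) E mul1mx.
Qed.

Lemma invmx_adj g : g \in unitmx -> invmx g = (\det g)^-1 *: \adj g.
Proof. by rewrite /invmx => ->. Qed.

Lemma mvge_inv g (k d : int) : g \in unitmx -> mvge g k -> val (\det g) <= d ->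
  mvge (invmx g) (k *+ n.-1 - d).
Proof.
move=> gu gk gd; rewrite invmx_adj// addrC; apply: mvgeZ; last exact: mvge_adj.
by move: gu; rewrite unitmx_det0 => gu; rewrite vge_val ?invr_eq0// valV//; lia.
Qed.

Lemma val_det_mul g h : g \in unitmx -> h \in unitmx ->
  val (\det (g *m h)) = val (\det g) + val (\det h).
Proof. by rewrite !unitmx_det0 det_mulmx => gu hu; rewrite (nlf_valM hF). Qed.

Lemma val_det_inv g : g \in unitmx -> val (\det (invmx g)) = - val (\det g).
Proof. by rewrite det_inv unitmx_det0; exact: valV. Qed.

Lemma GLO1 : K 1%:M.
Proof. by split; [exact: mvge1|rewrite det1 oner_eq0 nval1]. Qed.

Lemma GLOM g h : K g -> K h -> K (g *m h).
Proof.
move=> Kg Kh; have [gu hu] := (GLO_unit Kg, GLO_unit Kh).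
case: Kg Kh => g1 [g2 g3] [h1 [h2 h3]]; split.
  by rewrite -[0 : int]addr0; apply: mvgeM.
split; first by rewrite det_mulmx mulf_neq0.
by rewrite val_det_mul// g3 h3.
Qed.

Lemma GLOV g : K g -> K (invmx g).
Proof.
move=> Kg; have gu := GLO_unit Kg; case: Kg => g1 [g2 g3]; split.
  by have := @mvge_inv g 0 0 gu g1; rewrite g3 mul0rn subr0; apply.
split; first by rewrite -unitmx_det0 unitmx_inv.
by rewrite val_det_inv// g3 oppr0.
Qed.

(** The principal congruence subgroup of level [k]. At [k = 0] it is all of [M_n(O_F)], not a group,
    whence the hypotheses [0 < k] wherever invertibility matters. *)
Definition Gam (k : nat) : set 'M[F]_n := [set g | mvge (g - 1%:M) k%:Z].

Lemma Gam_GLO k g : (0 < k)%N -> Gam k g -> K g.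
Proof.
move=> k0 hg; have hg1 : mvge (g - 1%:M) 1 by apply: mvge_le hg; lia.
have g0 : mvge g 0.
  by rewrite -[g](subrK 1%:M); apply: mvgeD; [apply: mvge_le hg1|exact: mvge1].
split=> //.
have := @vge_det_cong n g 1%:M 1 isT g0 (@mvge1 n) hg1.
rewrite det1 => h; have [|? ->] := @val_near 1 (\det g) (oner_neq0 _).
  by rewrite nval1.
by rewrite nval1.
Qed.

Lemma Gam1 k : Gam k 1%:M.
Proof. by rewrite /Gam /= subrr; exact: mvge0. Qed.

Lemma GamS k l g : (k <= l)%N -> Gam l g -> Gam k g.
Proof. by move=> kl; apply: mvge_le; lia. Qed.

Lemma GamM k g h : Gam k g -> Gam k h -> Gam k (g *m h).
Proof.
rewrite /Gam /= => hg hh.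
have -> : g *m h - 1%:M = (g - 1%:M) *m h + (h - 1%:M).
  by rewrite mulmxBl mul1mx addrA subrK.
apply: mvgeD => //; rewrite -[k%:Z]addr0; apply: mvgeM => //.
rewrite -[h](subrK 1%:M); apply: mvgeD; [by apply: mvge_le hh; lia|exact: mvge1].
Qed.

Lemma GamV k g : (0 < k)%N -> Gam k g -> Gam k (invmx g).
Proof.
move=> k0 hg; have Kg := Gam_GLO k0 hg; have [g1 _] := GLOV Kg.
rewrite /Gam /=.
have -> : invmx g - 1%:M = - (invmx g *m (g - 1%:M)).
  by rewrite mulmxBr mulmx1 mulVmx ?GLO_unit// opprB.
by apply: mvgeN; rewrite -[k%:Z]add0r; apply: mvgeM.
Qed.

(** Together with [Gam_mball]: near an invertible [g], additive balls and multiplicative cosets of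
    congruence subgroups define the same neighbourhoods. *)
Lemma mball_Gam g k : g \in unitmx ->
  exists l : nat, forall h, mball val g l%:Z h -> Gam k (invmx g *m h).
Proof.
move=> gu; have [m hm] := mvge_exists (invmx g).
exists (k + m)%N => h /mballE hh; rewrite /Gam /=.
have -> : invmx g *m h - 1%:M = invmx g *m (h - g) by rewrite mulmxBr mulVmx.
apply: (@mvge_le _ _ (- m%:Z + (k + m)%N%:Z)); first by lia.
exact: mvgeM.
Qed.

Lemma Gam_mball g (l : nat) :
  exists2 k : nat, (0 < k)%N & forall h, Gam k h -> mball val g l%:Z (g *m h).
Proof.
have [m hm] := mvge_exists g; exists (l + m).+1 => // h hh; apply/mballE.
have -> : g *m h - g = g *m (h - 1%:M) by rewrite mulmxBr mulmx1.
apply: (@mvge_le _ _ (- m%:Z + (l + m).+1%:Z)); first by lia.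
exact: mvgeM.
Qed.

(** Replaces the maximum, with its side condition on zero entries, by lattice membership and a
    determinant bound; later estimates use this form. *)
Lemma ovG_le g (C : int) :
  ovG val g <= C <-> mvge g (- C) /\ val (\det g) <= C.
Proof.
rewrite /ovG; split.
- move=> h; split.
    move=> i j; have [->|g0] := eqVneq (g i j) 0; first exact: vge0.
    rewrite vge_val// lerNl; apply: le_trans h.
    exact: (@le_bigmax_cond _ _ _ _ (i, j) (fun ij : 'I_n * 'I_n => g ij.1 ij.2 != 0)
      (fun ij => - val (g ij.1 ij.2))).
  by apply: le_trans h; rewrite bigmax_idl le_max lexx.
- move=> [h1 h2]; apply: bigmax_le => // -[i j] /= g0.
  by have := h1 i j; rewrite vge_val//; lia.
Qed.

Lemma ovG_ge0 g : g \in unitmx -> 0 <= ovG val g.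
Proof.
move=> gu; rewrite leNgt; apply/negP => h.
have /ovG_le[h1 h2] : ovG val g <= -1 by lia.
have := vge_det h1; rewrite vge_val -?unitmx_det0//.
by rewrite opprK natz => h3; lia.
Qed.

Lemma GiM i j g h : Gi F val n i g -> Gi F val n j h -> Gi F val n (i + j) (g *m h).
Proof.
move=> [gu /ovG_le[g1 g2]] [hu /ovG_le[h1 h2]]; split; first by rewrite unitmx_mul gu.
apply/ovG_le; split.
  by apply: (@mvge_le _ _ (- i%:Z + - j%:Z)); [lia|exact: mvgeM].
by rewrite val_det_mul//; lia.
Qed.

(** Where [n] comes from: the adjugate costs [(n - 1) i] and the inverse determinant [i], while
    [val (\det g)] is at least [- n i]. *)
Lemma GiV i g : (0 < n)%N -> Gi F val n i g -> Gi F val n (n * i) (invmx g).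
Proof.
move=> n0 [gu /ovG_le[g1 g2]]; split; first by rewrite unitmx_inv.
apply/ovG_le; split.
  apply: mvge_le (mvge_inv gu g1 g2).
  by rewrite mulNrn -mulr_natr; case: n n0 => // m _ /=; rewrite natz; lia.
rewrite val_det_inv// lerNl; have := vge_det g1.
rewrite vge_val -?unitmx_det0//; apply: le_trans.
by rewrite mulNrn -mulr_natr natz; lia.
Qed.

Lemma GLO_Gi g : K g -> Gi F val n 0 g.
Proof.
move=> Kg; split; first exact: GLO_unit.
by apply/ovG_le; case: Kg => h1 [_ h2]; split; rewrite ?oppr0// h2.
Qed.

End Groups.
End Valuation.

(** * The valuation topology and its Borel sets *)

Section Topology.
Variables (F : fieldType) (val : F -> int).
Hypothesis hF : nonarch_local_field val.

Local Notation vge := (vge val).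
Local Notation mvge := (mvge val).

Lemma uniformizerX (m : nat) : exists2 p : F, p != 0 & val p = m%:Z.
Proof.
have [pi [pi0 vpi]] := nlf_unif hF; exists (pi ^+ m); first by rewrite expf_neq0.
by rewrite (valX hF)// vpi natz.
Qed.

(** Digit expansion: a class modulo the [N]-th power of the maximal ideal is refined by one further
    residue class. *)
Lemma finite_approx0 (N : nat) : exists s : seq F,
  forall x, vge x 0 -> exists2 y, y \in s & vge (x - y) N%:Z.
Proof.
elim: N => [|N [s hs]].
  by exists [:: 0] => x hx; exists 0; rewrite ?inE// subr0.
have [s1 hs1] := nlf_resfin hF; have [p p0 vp] := uniformizerX N.
exists [seq y + p * z | y <- s, z <- s1] => x hx.
have [y ys hy] := hs x hx.
have : vge ((x - y) / p) 0.
  rewrite -[0](subrr N%:Z).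
  apply: vgeM => //; by rewrite vge_val ?invr_eq0// (valV hF)// vp.
move/hs1 => [z zs hz]; exists (y + p * z); first exact: allpairs_f.
have -> : x - (y + p * z) = p * ((x - y) / p - z) by field.
have -> : N.+1%:Z = N%:Z + 1 by lia.
by apply: vgeM => //; rewrite vge_val// vp.
Qed.

Lemma finite_approx (a N : nat) : exists s : seq F,
  forall x, vge x (- a%:Z) -> exists2 y, y \in s & vge (x - y) N%:Z.
Proof.
have [s hs] := finite_approx0 (N + a); have [p p0 vp] := uniformizerX a.
exists [seq y / p | y <- s] => x hx.
have : vge (x * p) 0.
  rewrite -[0](addNr a%:Z).
  by apply: vgeM => //; rewrite vge_val// vp.
move/hs => [y ys hy]; exists (y / p); first exact: map_f.
have -> : x - y / p = (x * p - y) / p by field.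
have -> : N%:Z = (N + a)%N%:Z + - a%:Z by lia.
by apply: vgeM => //; rewrite vge_val ?invr_eq0// (valV hF)// vp.
Qed.

Section Matrices.
Variable n : nat.
Implicit Types (A B g h : 'M[F]_n).

Lemma finite_mx_approx (a N : nat) : exists s : seq 'M[F]_n,
  forall A, mvge A (- a%:Z) -> exists2 B, B \in s & mvge (A - B) N%:Z.
Proof.
have [s hs] := finite_approx a N.
exists [seq map_mx (fun i : 'I_(size s) => s`_i) C | C <- enum {: 'M['I_(size s)]_n}] => A hA.
have H (ij : 'I_n * 'I_n) : exists k : 'I_(size s), vge (A ij.1 ij.2 - s`_k) N%:Z.
  have [y ys hy] := hs _ (hA ij.1 ij.2).
  have ks : (index y s < size s)%N by rewrite index_mem.
  by exists (Ordinal ks); rewrite /= nth_index.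
have [k hk] := choice H.
exists (map_mx (fun i : 'I_(size s) => s`_i) (\matrix_(i, j) k (i, j))).
  by apply: map_f; rewrite mem_enum.
by move=> i j; rewrite !mxE; apply: (hk (i, j)).
Qed.

Lemma mball_refl g k : mball val g k g.
Proof. by apply/mballE; rewrite subrr; exact: mvge0. Qed.

Lemma mball_sym g h k : mball val g k h -> mball val h k g.
Proof. by move=> /mballE H; apply/mballE; rewrite -opprB; exact: (mvgeN hF). Qed.

Lemma mball_trans h g g' k : mball val g k h -> mball val h k g' -> mball val g k g'.
Proof.
move=> /mballE H1 /mballE H2; apply/mballE.
by rewrite -(subrK h g') -addrA; exact: (mvgeD hF).
Qed.

Lemma mball_le g h k l : l <= k -> mball val g k h -> mball val g l h.
Proof. by move=> lk /mballE H; apply/mballE; exact: mvge_le H. Qed.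

(** Separability, from finite nets at all radii. It makes every open set a countable union of balls,
    hence Borel. *)
Lemma mx_dense : exists d : nat -> 'M[F]_n,
  forall g (k : nat), exists m, mball val g k%:Z (d m).
Proof.
have [S hS] := choice (fun k => finite_mx_approx k k).
exists (fun m => if unpickle m is Some (k, l) then nth 0 (S k) l else 0) => g k.
have [a ha] := mvge_exists val g.
have [|B Bs hB] := hS (maxn k a) g; first by apply: mvge_le ha; lia.
exists (pickle (maxn k a, index B (S (maxn k a)))); rewrite pickleK nth_index//.
apply: mball_sym; apply/mballE; apply: mvge_le hB; lia.
Qed.

Definition mopen (U : set 'M[F]_n) :=
  forall g, U g -> exists k : nat, mball val g k%:Z `<=` U.

Lemma mopen_measurable (U : set 'M[F]_n) : mopen U -> measurable (U : set (MT val n)).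
Proof.
move=> oU; have [d hd] := mx_dense.
have -> : U = \bigcup_m \bigcup_k
    (if `[< mball val (d m) k%:Z `<=` U >] then mball val (d m) k%:Z else set0).
  apply/seteqP; split=> [g Ug|g [m _ [k _]]]; last by case: asboolP => // h; exact: h.
  have [k kU] := oU g Ug; have [m hm] := hd g k.
  exists m => //; exists k => //; case: asboolP => [_|[]]; first exact: mball_sym.
  by move=> h hh; apply: kU; exact: mball_trans hh.
apply: bigcupT_measurable => m; apply: bigcupT_measurable => k.
case: asboolP => _; last exact: measurable0.
by apply: sub_sigma_algebra; exists (d m), k%:Z.
Qed.

(** By separability the product sigma-algebra contains the open sets of the product; multiplication
    is thus jointly measurable, as Tonelli's theorem requires. *)
Lemma mopen2_measurable (U : set ('M[F]_n * 'M[F]_n)) :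
  (forall p, U p -> exists k : nat, forall h h', mball val p.1 k%:Z h ->
    mball val p.2 k%:Z h' -> U (h, h')) ->
  measurable (U : set (MT val n * MT val n)).
Proof.
move=> oU; have [d hd] := mx_dense.
pose B m m' (k : nat) : set (MT val n * MT val n) :=
  (mball val (d m) k%:Z : set (MT val n)) `*` (mball val (d m') k%:Z : set (MT val n)).
have -> : U = \bigcup_m \bigcup_m' \bigcup_k
    (if `[< B m m' k `<=` U >] then B m m' k else set0).
  apply/seteqP; split=> [[g g'] Ug|g [m _ [m' _ [k _]]]]; last by case: asboolP => // h; exact: h.
  have [k kU] := oU _ Ug; have [m hm] := hd g k; have [m' hm'] := hd g' k.
  exists m => //; exists m' => //; exists k => //; case: asboolP => [_|[]].
    by split; exact: mball_sym.
  by move=> [h h'] [/= hh hh']; apply: kU; [exact: mball_trans hh|exact: mball_trans hh'].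
apply: bigcupT_measurable => m; apply: bigcupT_measurable => m'.
apply: bigcupT_measurable => k.
case: asboolP => _; last exact: measurable0.
by apply: measurableX; apply: sub_sigma_algebra; [exists (d m), k%:Z|exists (d m'), k%:Z].
Qed.

Lemma mball_open g k : mopen (mball val g k).
Proof.
move=> h hh; exists `|k|%N => h' hh'; apply: (mball_trans hh).
by apply: mball_le hh'; lia.
Qed.

Lemma mulmx_near g g' (k : nat) : exists l : nat, forall h h', mball val g l%:Z h ->
  mball val g' l%:Z h' -> mball val (g *m g') k%:Z (h *m h').
Proof.
have [a ha] := mvge_exists val g; have [b hb] := mvge_exists val g'.
exists (k + a + b)%N => h h' /mballE hh /mballE hh'; apply/mballE.
have -> : h *m h' - g *m g' = (h - g) *m (h' - g') + (h - g) *m g' + g *m (h' - g').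
  by rewrite -mulmxDr subrK mulmxBl mulmxBr addrA subrK.
apply: (mvgeD hF); first apply: (mvgeD hF).
- by apply: mvge_le (mvgeM hF hh hh'); lia.
- by apply: mvge_le (mvgeM hF hh hb); lia.
- by apply: mvge_le (mvgeM hF ha hh'); lia.
Qed.

Lemma measurable_fun_mball d (X : measurableType d) (f : X -> MT val n) :
  (forall g k, measurable (f @^-1` mball val g k)) -> measurable_fun setT f.
Proof.
move=> H; refine (@measurability _ _ X (MT val n) setT f (mballs F val n) erefl _).
by move=> _ [_ [g [k ->]] <-]; rewrite setTI.
Qed.

Lemma measurable_mulmx :
  measurable_fun setT (fun p : MT val n * MT val n => (p.1 *m p.2 : MT val n)).
Proof.
apply: measurable_fun_mball => g k; apply: mopen2_measurable => -[h h'] /= H.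
have [l hl] := mulmx_near h h' `|k|; exists l => f f' hf hf' /=.
by apply: (mball_trans H); apply: mball_le (hl _ _ hf hf'); lia.
Qed.

Lemma measurable_mulmxl g : measurable_fun setT (fun h : MT val n => (g *m h : MT val n)).
Proof.
exact: (measurableT_comp measurable_mulmx
  (measurable_fun_pair (measurable_cst _) (@measurable_id _ _ _))).
Qed.

Lemma measurable_mulmxr g : measurable_fun setT (fun h : MT val n => (h *m g : MT val n)).
Proof.
exact: (measurableT_comp measurable_mulmx
  (measurable_fun_pair (@measurable_id _ _ _) (measurable_cst _))).
Qed.

Lemma GL_Gam_open (U : set 'M[F]_n) : U `<=` GL F n ->
  (forall g, U g -> exists k, forall h, Gam val k h -> U (g *m h)) -> mopen U.
Proof.
move=> UG H g Ug; have [k hk] := H g Ug; have gu : g \in unitmx := UG g Ug.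
have [l hl] := mball_Gam hF k gu; exists l => h hh.
by rewrite -[h](mulKVmx gu); exact/hk/hl.
Qed.

Lemma GL_open : mopen (GL F n).
Proof.
apply: GL_Gam_open => // g gu; exists 1%N => h hh.
by rewrite /GL /= unitmx_mul gu; apply: GLO_unit; exact: Gam_GLO hh.
Qed.

Lemma invmx_near g (k : nat) : g \in unitmx -> exists l : nat, forall h,
  mball val g l%:Z h -> h \in unitmx /\ mball val (invmx g) k%:Z (invmx h).
Proof.
move=> gu; have [a ha] := mvge_exists val (invmx g).
have [l hl] := mball_Gam hF (k + a).+1 gu.
exists l => h /hl; set f := invmx g *m h => hf.
have fu : f \in unitmx by apply: GLO_unit (Gam_GLO hF _ hf).
have hE : h = g *m f by rewrite mulKVmx.
have hu : h \in unitmx by rewrite hE unitmx_mul gu.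
split=> //; apply/mballE.
have -> : invmx h - invmx g = (invmx f - 1%:M) *m invmx g.
  by rewrite mulmxBl mul1mx [in LHS]hE invmx_mul.
have := GamV hF (ltn0Sn _) hf; rewrite /Gam /= => H.
by apply: mvge_le (mvgeM hF H ha); lia.
Qed.

Lemma measurable_GL : measurable (GL F n : set (MT val n)).
Proof. exact: mopen_measurable GL_open. Qed.

Lemma measurable_invmx : measurable_fun setT (fun g : MT val n => (invmx g : MT val n)).
Proof.
apply: measurable_fun_mball => g k.
(* [invmx] is the identity on singular matrices, so the preimage splits into an open part inside
   [GL] and the part of the ball outside it. *)
have -> : (fun g : MT val n => (invmx g : MT val n)) @^-1` mball val g k =
   [set h : MT val n | h \in unitmx /\ mball val g k (invmx h)] `|`
   (mball val g k `\` GL F n).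
  apply/seteqP; split=> h /=.
    case: (boolP (h \in unitmx)) => hu H; first by left.
    right; split; last exact/negP.
    by move: H; rewrite /invmx (negPf hu).
  by move=> [[_ //]|[H /negP hu]]; rewrite /invmx (negPf hu).
apply: measurableU.
  apply: mopen_measurable => h [hu H].
  have [l hl] := invmx_near `|k| hu; exists l => f /hl [fu hf]; split=> //.
  by apply: (mball_trans H); apply: mball_le hf; lia.
by apply: measurableD; [apply: mopen_measurable; exact: mball_open|exact: measurable_GL].
Qed.

(** * Sequential compactness of bounded sets of matrices *)

Definition frequently (P : set nat) := forall N : nat, exists2 m, (N <= m)%N & P m.

Lemma frequently_pigeonhole (T : eqType) (s : seq T) (P : set nat) (Q : T -> set nat) :
  frequently P -> (forall m, exists2 y, y \in s & Q y m) ->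
  exists y, frequently (P `&` Q y).
Proof.
move=> fP H; apply: contrapT => /forallNP nf.
have {}nf y : exists N : nat, forall m, (N <= m)%N -> P m -> ~ Q y m.
  have /existsNP[N hN] := nf y; exists N => m Nm Pm Qm; apply: hN.
  by exists m.
have [N hN] := choice nf.
have [m mN Pm] := fP (\max_(y <- s) N y)%N.
have [y ys Qy] := H m; apply: (hN y m) => //.
by apply: leq_trans mN; exact: leq_bigmax_seq.
Qed.

Lemma mx_complete (u : nat -> 'M[F]_n) :
  (forall k p q, (k <= p)%N -> (k <= q)%N -> mvge (u p - u q) k%:Z) ->
  exists l, forall k, mvge (u k - l) k%:Z.
Proof.
move=> cu.
have H (ij : 'I_n * 'I_n) : exists l, forall k : int, exists N : nat, forall p : nat,
    (N <= p)%N -> vge (u p ij.1 ij.2 - l) k.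
  apply: (nlf_complete hF) => k; exists `|k|%N => p q hp hq.
  have /(_ ij.1 ij.2) := cu _ _ _ hp hq; rewrite !mxE; apply: vge_le; lia.
have [l hl] := choice H; exists (\matrix_(i, j) l (i, j)) => k i j.
have [N hN] := hl (i, j) k%:Z; rewrite !mxE.
have := hN (maxn N k) (leq_maxl _ _).
have /(_ i j) := cu k k (maxn N k) (leqnn _) (leq_maxr _ _); rewrite !mxE /= => h1 h2.
by have := vgeD hF h1 h2; rewrite addrA subrK.
Qed.

(** Bolzano-Weierstrass without subsequences: [l] is a cluster point, approached at every precision
    along infinitely many indices. *)
Lemma mx_bolzano (u : nat -> 'M[F]_n) (a : nat) : (forall m, mvge (u m) (- a%:Z)) ->
  exists l, forall k : nat, frequently [set m | mvge (u m - l) k%:Z].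
Proof.
move=> hu.
have H (Pk : set nat * nat) : exists y, frequently Pk.1 ->
    frequently (Pk.1 `&` [set m | mvge (u m - y) Pk.2%:Z]).
  case: Pk => P k /=; case: (pselect (frequently P)) => [fP|]; last by exists 0.
  have [s hs] := finite_mx_approx a k.
  have [y hy] := frequently_pigeonhole (Q := fun y => [set m | mvge (u m - y) k%:Z]) fP
    (fun m => hs _ (hu m)).
  by exists y.
have [f hf] := choice H.
(* Each [P k] is an infinite set of indices; the next one keeps those whose terms lie in a single
   ball of level [k], provided by the pigeonhole principle. *)
pose fix P (k : nat) : set nat := if k is k'.+1 then
  P k' `&` [set m | mvge (u m - f (P k', k')) k'%:Z] else setT.
have fP k : frequently (P k).
  elim: k => [|k IH]; first by move=> N; exists N.
  exact: (hf (P k, k)).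
pose y k := f (P k, k).
have PS p q : (p <= q)%N -> P q `<=` P p.
  elim: q => [|q IH]; first by rewrite leqn0 => /eqP ->.
  rewrite leq_eqVlt => /predU1P[->//|]; rewrite ltnS => /IH h.
  by move=> m [/h].
have Py k m : P k.+1 m -> mvge (u m - y k) k%:Z by case.
have cy k p q : (k <= p)%N -> (k <= q)%N -> mvge (y p - y q) k%:Z.
  move=> kp kq; have [m _ Pm] := fP (maxn p q).+1 0.
  have h1 := Py p m (PS _ _ (leq_ltn_trans (leq_maxl p q) (leqnn _)) _ Pm).
  have h2 := Py q m (PS _ _ (leq_ltn_trans (leq_maxr p q) (leqnn _)) _ Pm).
  have -> : y p - y q = (u m - y q) - (u m - y p) by rewrite opprB [RHS]addrC addrA subrK.
  by apply: (mvgeB hF); [apply: mvge_le h2; lia|apply: mvge_le h1; lia].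
have [l hl] := mx_complete cy; exists l => k N.
have [m Nm Pm] := fP k.+1 N; exists m => //=.
rewrite -(subrK (y k) (u m)) -addrA; apply: (mvgeD hF) => //; exact: Py.
Qed.

End Matrices.
End Topology.

(** * Positive characters of GL_n *)

Section GLCharacter.
Variables (R : realType) (F : fieldType) (val : F -> int).
Hypothesis hF : nonarch_local_field val.
Variable n : nat.
Implicit Types g h : 'M[F]_n.+1.

Record positive_character (c : 'M[F]_n.+1 -> R) : Prop := {
  pc_ge0 : forall g, 0 <= c g;
  pc_mul : forall g h, g \in unitmx -> h \in unitmx -> c (g *m h) = c g * c h;
  pc_GLO : forall g, GLO F val n.+1 g -> c g = 1;
  pc_scalar : forall a : F, a != 0 -> c a%:M = 1 }.

Lemma perm_mx_GLO (s : 'S_n.+1) : GLO F val n.+1 (perm_mx s).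
Proof.
split; first by move=> i j; rewrite !mxE; case: (s i == j); rewrite ?vge0 ?(vge1 hF).
rewrite det_perm; case: (odd_perm s); rewrite ?expr0 ?expr1.
  by rewrite oppr_eq0 oner_eq0 (nvalN1 hF).
by rewrite oner_eq0 (nval1 hF).
Qed.

Lemma unitmx_diag (d : 'rV[F]_n.+1) : (forall i, d 0 i != 0) -> diag_mx d \in unitmx.
Proof. by move=> h; rewrite unitmx_det0 det_diag; apply/prodf_neq0 => i _. Qed.

Lemma perm_mx_conj_diag (s : 'S_n.+1) (d : 'rV[F]_n.+1) :
  perm_mx s *m diag_mx d *m perm_mx s^-1%g = diag_mx (\row_i d 0 (s i)).
Proof.
rewrite -row_permE -col_permE; apply/matrixP => i j; rewrite !mxE.
by rewrite (inj_eq perm_inj).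
Qed.

Section Fix.
Variable c : 'M[F]_n.+1 -> R.
Hypothesis hc : positive_character c.

Lemma pc_prod (I : Type) (r : seq I) (f : I -> 'M[F]_n.+1) :
  (forall i, f i \in unitmx) ->
  (\prod_(i <- r) f i \in unitmx) /\ c (\prod_(i <- r) f i) = \prod_(i <- r) c (f i).
Proof.
move=> fu; elim: r => [|i r [IH1 IH2]].
  by rewrite !big_nil unitmx1; split=> //; apply: (pc_GLO hc); exact: GLO1.
rewrite !big_cons; split; first by rewrite -mulmxE unitmx_mul fu.
by rewrite -mulmxE (pc_mul hc)// IH2.
Qed.

Lemma pc_conj g h : g \in unitmx -> h \in unitmx -> c (g *m h *m invmx g) = c h.
Proof.
move=> gu hu; rewrite !(pc_mul hc) ?unitmx_mul ?gu ?unitmx_inv//.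
rewrite mulrAC -(pc_mul hc) ?unitmx_inv// mulmxV// (pc_GLO hc) ?mul1r//.
exact: GLO1.
Qed.

Lemma pc_diag (d : 'rV[F]_n.+1) : (forall i, d 0 i != 0) -> c (diag_mx d) = 1.
Proof.
(* [s k] is the cyclic shift by [k], so each diagonal entry of the product of the [D k] runs over
   all [d 0 i]. The value of [c] then has [n.+1]-st power 1, and being nonnegative it is 1. *)
move=> d0; pose s (k : 'I_n.+1) := perm (addIr k).
pose D k : 'M[F]_n.+1 := diag_mx (\row_i d 0 (s k i)).
have Du k : D k \in unitmx by apply: unitmx_diag => i; rewrite mxE.
have cD k : c (D k) = c (diag_mx d).
  rewrite /D -perm_mx_conj_diag perm_mxV pc_conj ?unitmx_perm//.
  exact: unitmx_diag.
have [_] := pc_prod (index_enum 'I_n.+1) Du.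
have -> : \prod_k D k = (\prod_i d 0 i)%:M.
  have H (r : seq 'I_n.+1) : \prod_(k <- r) D k = diag_mx (\row_i \prod_(k <- r) d 0 (s k i)).
    elim: r => [|k r IH]; first by rewrite big_nil; apply/matrixP=> i j; rewrite !mxE big_nil.
    rewrite big_cons IH -mulmxE mulmx_diag; congr diag_mx; apply/rowP => i.
    by rewrite !mxE big_cons.
  rewrite H -diag_const_mx; congr diag_mx; apply/rowP => i; rewrite !mxE.
  rewrite [RHS](reindex_inj (addrI i)) /=; apply: eq_bigr => k _.
  by rewrite permE.
rewrite (pc_scalar hc); last exact/prodf_neq0.
rewrite (eq_bigr _ (fun k _ => cD k)) prodr_const card_ord => /esym/eqP.
by rewrite pexpr_eq1 ?(pc_ge0 hc)// => /eqP.
Qed.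

(* Conjugation by [diag (p^(n-i))] contracts the entries above the diagonal. *)
Lemma pc_upper (U : 'M[F]_n.+1) : (forall i j : 'I_n.+1, (j < i)%N -> U i j = 0) ->
  (forall i, U i i != 0) -> c U = 1.
Proof.
move=> Ut Ud; pose e : 'rV[F]_n.+1 := \row_i U i i.
have e0 i : e 0 i != 0 by rewrite mxE.
pose V := invmx (diag_mx e) *m U.
have UE : U = diag_mx e *m V by rewrite mulKVmx ?unitmx_diag.
have Vt (i j : 'I_n.+1) : (j < i)%N -> V i j = 0.
  move=> ji; have := Ut i j ji; rewrite UE mul_diag_mx mxE => /eqP.
  by rewrite mulf_eq0 (negPf (e0 i)) => /eqP.
have Vd i : V i i = 1.
  have := erefl (U i i); rewrite {1}UE mul_diag_mx mxE [e 0 i]mxE => h.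
  by apply: (mulfI (Ud i)); rewrite h mulr1.
have Vdet : \det V = 1.
  rewrite -det_tr det_trig; last by apply/is_trig_mxP => i j ij; rewrite mxE Vt.
  by rewrite big1// => i _; rewrite mxE Vd.
have Vu : V \in unitmx by rewrite unitmx_det0 Vdet oner_eq0.
rewrite UE (pc_mul hc) ?unitmx_diag// pc_diag// mul1r.
(* Conjugation multiplies the entry [(i, j)] by [p ^+ (j - i)]. As entries of [V] have valuation at
   least [- a], a single [p] of valuation [a] makes the strictly upper part integral. *)
have [a ha] := mvge_exists val V; have [p p0 vp] := uniformizerX hF a.
pose d : 'rV[F]_n.+1 := \row_i p ^+ (n - i).
have d0 i : d 0 i != 0 by rewrite mxE expf_neq0.
have du := unitmx_diag d0.
rewrite -(pc_conj du Vu); apply: (pc_GLO hc).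
pose W := diag_mx d *m V *m invmx (diag_mx d).
have WE i j : W i j * d 0 j = d 0 i * V i j.
  have : (W *m diag_mx d) i j = (diag_mx d *m V) i j by rewrite /W mulmxKV.
  by rewrite mul_mx_diag mul_diag_mx !mxE.
split; last first.
  have -> : \det (diag_mx d *m V *m invmx (diag_mx d)) = 1.
    by rewrite 2!det_mulmx det_inv Vdet mulr1 divff// -unitmx_det0.
  by rewrite oner_eq0 (nval1 hF).
move=> i j; rewrite -/W.
have {WE} WE : W i j = d 0 i * V i j / d 0 j by rewrite -WE mulfK.
rewrite WE; have [ji|] := ltnP j i; first by rewrite Vt// mulr0 mul0r vge0.
rewrite leq_eqVlt => /predU1P[ij|ij].
  by rewrite (ord_inj ij) Vd mulr1 divff// (vge1 hF).
rewrite mulrAC; apply: (@vge_le _ _ _ (a%:Z + - a%:Z)); first by rewrite subrr.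
apply: (vgeM hF) => //.
have jn := ltn_ord j; rewrite !mxE.
have -> : (n - i = (n - j) + (j - i))%N by lia.
rewrite exprD mulrAC divff ?expf_neq0// mul1r.
have -> : (j - i = (j - i).-1.+1)%N by lia.
rewrite exprS -[a%:Z]addr0; apply: (vgeM hF); first by rewrite vge_val ?vp.
by have := @vgeX _ _ hF p 0 (j - i).-1; rewrite mul0rn; apply; rewrite vge_val// vp.
Qed.

End Fix.

Lemma positive_character_trivial c : positive_character c ->
  forall g, g \in unitmx -> c g = 1.
Proof.
move=> hc g gu.
(* Transposition reverses products, which real values do not see; this reduces the lower triangular
   factor to the upper triangular case. *)
have hct : positive_character (fun g => c g^T).
  split=> [h|h h' hu hu'|h [h1 [h2 h3]]|a a0].
  - exact: (pc_ge0 hc).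
  - by rewrite trmx_mul (pc_mul hc) ?unitmx_tr// mulrC.
  - by apply: (pc_GLO hc); rewrite /GLO /= det_tr; split=> // i j; rewrite mxE; exact: h1.
  - by rewrite tr_scalar_mx (pc_scalar hc).
have hP := cormen_lup_perm g; have hE := cormen_lup_correct g.
have hL := cormen_lup_lower g; have hU := cormen_lup_upper g.
have hD := cormen_lup_detL g.
case: (cormen_lup g) hP hE hL hU hD => [[P L] U] /= /is_perm_mxP[s ->].
rewrite -!mulmxE => hE hL hU hD.
have Lu : L \in unitmx by rewrite unitmx_det0 hD oner_eq0.
have Pu := unitmx_perm F s.
have Uu : U \in unitmx by rewrite -[U](mulKmx Lu) unitmx_mul unitmx_inv Lu -hE unitmx_mul Pu.
have cL : c L = 1.
  rewrite -[L]trmxK; apply: (pc_upper hct) => [i j ij|i]; rewrite !mxE.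
    by rewrite hL ?(ltnW ij)// -val_eqE /= ltn_eqF.
  by rewrite hL// eqxx oner_eq0.
have cU : c U = 1.
  apply: (pc_upper hc) => // i.
  have : \det U != 0 by rewrite -unitmx_det0.
  rewrite -det_tr det_trig; last by apply/is_trig_mxP => p q pq; rewrite mxE hU.
  by move/prodf_neq0 => /(_ i isT); rewrite mxE.
have := congr1 c hE; rewrite !(pc_mul hc)// cL cU mulr1 (pc_GLO hc) ?mul1r//.
exact: perm_mx_GLO.
Qed.

End GLCharacter.

(** * Haar measures and unimodularity *)

Section SigmaFiniteCopy.
Context d (T : measurableType d) (R : realType) (m : {measure set T -> \bar R}).
Hypothesis s : sigma_finite setT m.
(** The same measure under a name that carries the hypothesis, so that the sigma-finite structure
    can be attached to it and Tonelli's theorem applied. *)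
Definition sigma_finite_copy of sigma_finite setT m : set T -> \bar R := m.
HB.instance Definition _ := Measure.copy (sigma_finite_copy s) m.
HB.instance Definition _ := Measure_isSigmaFinite.Build _ _ _ (sigma_finite_copy s) s.
End SigmaFiniteCopy.

Lemma tonelli d (T : measurableType d) (R : realType)
  (m1 m2 : {measure set T -> \bar R}) (f : T * T -> \bar R) :
  sigma_finite setT m1 -> sigma_finite setT m2 ->
  measurable_fun [set: T * T] f -> (forall x, (0 <= f x)%E) ->
  (\int[m1]_x \int[m2]_y f (x, y) = \int[m2]_y \int[m1]_x f (x, y))%E.
Proof.
move=> s1 s2 mf f0.
exact: (@fubini_tonelli _ _ _ _ _ (sigma_finite_copy s1) (sigma_finite_copy s2)).
Qed.

Lemma measurable_fun_tonelli d (T : measurableType d) (R : realType)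
  (m : {measure set T -> \bar R}) (f : T * T -> \bar R) :
  sigma_finite setT m -> measurable_fun [set: T * T] f -> (forall x, (0 <= f x)%E) ->
  measurable_fun setT (fun x => \int[m]_y f (x, y))%E.
Proof.
move=> s mf f0.
exact: (@measurable_fun_fubini_tonelli_F _ _ _ _ _ (sigma_finite_copy s) f mf f0).
Qed.

Lemma measurable_fun_tonelli2 d (T : measurableType d) (R : realType)
  (m : {measure set T -> \bar R}) (f : T * T -> \bar R) :
  sigma_finite setT m -> measurable_fun [set: T * T] f -> (forall x, (0 <= f x)%E) ->
  measurable_fun setT (fun y => \int[m]_x f (x, y))%E.
Proof.
move=> s mf f0.
exact: (@measurable_fun_fubini_tonelli_G _ _ _ _ _ (sigma_finite_copy s) f mf f0).
Qed.

Lemma ge0_integral_invariant d (T : measurableType d) (R : realType)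
  (m : {measure set T -> \bar R}) (phi : T -> T) (f : T -> \bar R) :
  measurable_fun setT phi -> (forall A, measurable A -> m (phi @^-1` A) = m A) ->
  measurable_fun setT f -> (forall x, (0 <= f x)%E) ->
  (\int[m]_x f (phi x) = \int[m]_x f x)%E.
Proof.
move=> mphi inv mf f0.
have := @ge0_integral_pushforward _ _ T T R phi mphi m setT f measurableT mf (fun y _ => f0 y).
rewrite preimage_setT => <-.
pose pm : {measure set T -> \bar R} :=
  measure_function_pushforward__canonical__measure_function_Measure m mphi.
by apply: (@eq_measure_integral _ T R setT m pm) => A mA _; exact: inv.
Qed.

Lemma ge0_integral_conull d (T : measurableType d) (R : realType)
  (m : {measure set T -> \bar R}) (H : set T) (f : T -> \bar R) :
  measurable H -> m (~` H) = 0%E -> measurable_fun setT f -> (forall x, (0 <= f x)%E) ->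
  (\int[m]_(x in H) f x = \int[m]_x f x)%E.
Proof.
move=> mH H0 mf f0.
rewrite [RHS](ge0_negligible_integral (measurableC mH))// ?measurableT//.
by rewrite setTD setCK.
Qed.

Section Haar.
Variables (R : realType) (F : fieldType) (val : F -> int).
Hypothesis hF : nonarch_local_field val.
Variable n : nat.
Local Notation MTn := (MT val n).

Record mx_subgroup (H : set 'M[F]_n) : Prop := {
  msg_unit : H `<=` GL F n;
  msg1 : H 1%:M;
  msgM : forall g h, H g -> H h -> H (g *m h);
  msgV : forall g, H g -> H (invmx g) }.

Lemma GL_subgroup : mx_subgroup (GL F n).
Proof.
split=> //=; first exact: unitmx1.
  by move=> g h; rewrite /GL /= unitmx_mul => -> ->.
by move=> g; rewrite /GL /= unitmx_inv.
Qed.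

(** Phrased through preimages, whose measurability follows from that of translations, and for all
    Borel sets of the matrix space instead of subsets of [H]. *)
Definition left_invariant (H : set MTn) (nu : {measure set MTn -> \bar R}) :=
  forall h (A : set MTn), H h -> measurable A ->
    nu ((fun g : MTn => (h *m g : MTn)) @^-1` A) = nu A.

Lemma measurable_preimage_mulmxl (h : MTn) (A : set MTn) : measurable A ->
  measurable ((fun g : MTn => (h *m g : MTn)) @^-1` A).
Proof. by move=> mA; rewrite -[X in measurable X]setTI; exact: (measurable_mulmxl hF h). Qed.

Lemma measurable_preimage_mulmxr (h : MTn) (A : set MTn) : measurable A ->
  measurable ((fun g : MTn => (g *m h : MTn)) @^-1` A).
Proof. by move=> mA; rewrite -[X in measurable X]setTI; exact: (measurable_mulmxr hF h). Qed.

Lemma measure_conull (H : set MTn) (nu : {measure set MTn -> \bar R}) (A : set MTn) :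
  measurable H -> measurable A -> nu (~` H) = 0%E -> nu A = nu (A `&` H).
Proof.
move=> mH mA H0; rewrite (measureDI _ mA mH).
rewrite [X in (X + _)%E](_ : _ = 0%E) ?add0e//.
apply/eqP; rewrite eq_le measure_ge0 andbT -H0; apply: le_measure.
- by rewrite inE; exact: measurableD.
- by rewrite inE; exact: measurableC.
- by move=> x [].
Qed.

Section HaarOn.
Variables (H K : set MTn) (nu : {measure set MTn -> \bar R}).
Hypotheses (gH : mx_subgroup H) (mH : measurable H) (hnu : haar_on H K nu).

Lemma haar_left_invariant : left_invariant H nu.
Proof.
have [H0 inv _] := hnu; move=> h A Hh mA.
have hu : h \in unitmx := msg_unit gH Hh.
have mB := measurable_preimage_mulmxl h mA.
rewrite (measure_conull mH mB H0) (measure_conull mH mA H0).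
rewrite -(inv h _ Hh (measurableI _ _ mB mH)); last by move=> x [].
congr (nu _); apply/seteqP; split=> [_ [g [Ag Hg] <-]|g [Ag Hg]] /=.
  by split=> //; exact: msgM.
exists (invmx h *m g); last exact: mulKVmx.
split; first by rewrite /= mulKVmx.
by apply: (msgM gH) => //; exact: (msgV gH).
Qed.

(** Countably many translates of [K], each of measure 1, cover [H], and the complement of [H] is
    null. *)
Lemma haar_sigma_finite : measurable K -> (forall h, H h -> Gam val 1 h -> K h) ->
  sigma_finite setT nu.
Proof.
move=> mK HK; have [H0 _ K1] := hnu; have [d hd] := mx_dense hF n.
(* The dense points need not lie in [H]: [r m] is an element of [H] whose [Gam 1]-coset contains
   [d m], whenever there is one. *)
pose P m h := H h /\ Gam val 1 (invmx h *m d m).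
have hP m : exists h, (exists h', P m h') -> P m h.
  case: (pselect (exists h', P m h')) => [[h hh]|nP]; first by exists h.
  by exists 0.
have [r hr] := choice hP.
pose A m : set MTn := if `[< exists h', P m h' >] then
  (fun g : MTn => (invmx (r m) *m g : MTn)) @^-1` K else set0.
exists (fun m => if m is m'.+1 then A m' else ~` H).
  apply/esym; rewrite -subTset => g _; case: (pselect (H g)) => Hg; last by exists 0%N.
  have gu : g \in unitmx := msg_unit gH Hg.
  have [l hl] := mball_Gam hF 1 gu; have [m /hl gm] := hd g l.
  have exP : exists h', P m h' by exists g.
  have [Hr rm] := hr m exP; have ru : r m \in unitmx := msg_unit gH Hr.
  exists m.+1 => //=; rewrite /A; case: asboolP => // _ /=.
  apply: HK; first by apply: (msgM gH) => //; exact: (msgV gH).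
  have E : invmx (r m) *m g = (invmx (r m) *m d m) *m invmx (invmx g *m d m).
    have fu : invmx g *m d m \in unitmx by apply: GLO_unit (Gam_GLO hF _ gm).
    by rewrite -[RHS]mulmxA; congr (_ *m _);
       rewrite -[d m in RHS](mulKVmx gu) mulKmx// -mulmxA mulmxV// mulmx1.
  rewrite E; apply: (GamM hF) => //; exact: (GamV hF).
move=> [|m]; first by split; [exact: measurableC|rewrite H0].
rewrite /A; case: asboolP => exP; last by rewrite measure0; split.
have [Hr rm] := hr m exP.
split; first exact: measurable_preimage_mulmxl.
by rewrite haar_left_invariant ?K1 ?ltry//; exact: (msgV gH).
Qed.

End HaarOn.

(** * Cosets of congruence subgroups as a generating family *)

Definition gcoset (g : 'M[F]_n) (k : nat) : set 'M[F]_n :=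
  [set h | Gam val k (invmx g *m h)].

Lemma gcoset_refl g k : g \in unitmx -> gcoset g k g.
Proof. by move=> gu; rewrite /gcoset /= mulVmx//; exact: Gam1. Qed.

Lemma gcoset_unit g k h : (0 < k)%N -> g \in unitmx -> gcoset g k h -> h \in unitmx.
Proof.
move=> k0 gu gh; rewrite -[h](mulKVmx gu) unitmx_mul gu.
by apply: GLO_unit (Gam_GLO hF k0 gh).
Qed.

Lemma gcoset_mono g k l : (k <= l)%N -> gcoset g l `<=` gcoset g k.
Proof. by move=> kl h; exact: GamS. Qed.

Lemma gcoset_eq g k h : (0 < k)%N -> g \in unitmx -> gcoset g k h -> gcoset g k = gcoset h k.
Proof.
move=> k0 gu gh; have hu := gcoset_unit k0 gu gh.
have fu : invmx g *m h \in unitmx by rewrite unitmx_mul unitmx_inv gu.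
apply/seteqP; split=> f hf; rewrite /gcoset /=.
  have -> : invmx h *m f = invmx (invmx g *m h) *m (invmx g *m f).
    by rewrite invmx_mul ?unitmx_inv// invmxK -mulmxA mulKVmx.
  by apply: (GamM hF) => //; exact: (GamV hF).
have -> : invmx g *m f = (invmx g *m h) *m (invmx h *m f) by rewrite -mulmxA mulKVmx.
exact: (GamM hF).
Qed.

Lemma gcoset_open g k : (0 < k)%N -> g \in unitmx -> mopen val (gcoset g k).
Proof.
move=> k0 gu; apply: (GL_Gam_open hF) => [h /(gcoset_unit k0 gu)//|h gh].
by exists k => f hf; rewrite /gcoset /= mulmxA; exact: (GamM hF).
Qed.

Lemma gcoset_measurable g k : (0 < k)%N -> g \in unitmx ->
  measurable (gcoset g k : set MTn).
Proof. by move=> *; apply: (mopen_measurable hF); exact: gcoset_open. Qed.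

Lemma GLO_open : mopen val (GLO F val n).
Proof.
apply: (GL_Gam_open hF) => [h /GLO_unit//|h Kh].
by exists 1%N => f hf; apply: (GLOM hF) => //; exact: (Gam_GLO hF (ltn0Sn 0)).
Qed.

Lemma GLO_measurable : measurable (GLO F val n : set MTn).
Proof. exact: (mopen_measurable hF GLO_open). Qed.

Lemma GLO_gcoset g k : GLO F val n g -> gcoset g k = mball val g k%:Z.
Proof.
move=> Kg; have [Kg1 _] := Kg; have gu := GLO_unit Kg; have [Kg2 _] := GLOV hF Kg.
apply/seteqP; split=> h; rewrite /gcoset /Gam /= => hh.
  apply/mballE; have -> : h - g = g *m (invmx g *m h - 1%:M).
    by rewrite mulmxBr mulmx1 mulKVmx.
  by rewrite -[k%:Z]add0r; exact: (mvgeM hF).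
have -> : invmx g *m h - 1%:M = invmx g *m (h - g) by rewrite mulmxBr mulVmx.
by rewrite -[k%:Z]add0r; apply: (mvgeM hF) => //; exact/mballE.
Qed.

Lemma sume_const (I : Type) (s : seq I) (x : \bar R) : (0 <= x)%E ->
  (\sum_(i <- s) x = (size s)%:R%:E * x)%E.
Proof.
move=> x0; elim: s => [|i s IH]; first by rewrite big_nil mul0e.
by rewrite big_cons IH /= -natr1 EFinD ge0_muleDl ?lee_fin// mul1e addrC.
Qed.

Lemma left_invariant_gcoset (lam : {measure set MTn -> \bar R}) g k :
  left_invariant (GL F n) lam -> (0 < k)%N -> g \in unitmx ->
  lam (gcoset g k) = lam (Gam val k).
Proof.
move=> linv k0 gu.
have mG : measurable (Gam val k : set MTn).
  have := gcoset_measurable k0 (unitmx1 F n); congr measurable.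
  by apply/seteqP; split=> h; rewrite /gcoset /= invmx1 mul1mx.
by rewrite -(linv (invmx g) _ _ mG)//= /GL /= unitmx_inv.
Qed.

(** What matters is the order of quantifiers: the same index [N] serves every left-invariant
    measure, so two of them can be compared through it. *)
Lemma GLO_index k : (0 < k)%N -> exists N : nat,
  forall lam : {measure set MTn -> \bar R}, left_invariant (GL F n) lam ->
    lam (GLO F val n) = (N%:R%:E * lam (Gam val k))%E.
Proof.
move=> k0; have [S hS] := @finite_mx_approx _ _ hF n 0 k.
(* The representative [f B] depends only on the ball as a set, so overlapping cosets share it; after
   [undup] the cosets are disjoint. *)
pose f B : 'M[F]_n := xget 0 (mball val B k%:Z `&` GLO F val n).
pose s := undup [seq f B | B <- S & `[< exists g, (mball val B k%:Z `&` GLO F val n) g >]].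
have hs g : g \in s -> exists2 B, g = f B & (mball val B k%:Z `&` GLO F val n) g.
  rewrite mem_undup => /mapP[B]; rewrite mem_filter => /andP[/asboolP[h hh] _] ->.
  by exists B => //; apply: xgetI hh.
have sK g : g \in s -> GLO F val n g by move=> /hs [B _ []].
have ballE (B h : 'M[F]_n) : mball val B k%:Z h -> mball val B k%:Z = mball val h k%:Z.
  move=> Bh; apply/seteqP; split=> x hx.
    by apply: (mball_trans hF) hx; exact: (mball_sym hF).
  exact: (mball_trans hF) hx.
have KE : GLO F val n = \bigcup_(g in [set` s]) gcoset g k.
  apply/seteqP; split=> [h Kh|h [g gs]].
    have [|B BS hB] := hS h; first by case: Kh; rewrite oppr0.
    have Bh : (mball val B k%:Z `&` GLO F val n) h by split=> //; exact/mballE.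
    have [fB fK] : (mball val B k%:Z `&` GLO F val n) (f B) by exact: xgetI Bh.
    exists (f B).
      by rewrite /= mem_undup; apply: map_f; rewrite mem_filter BS andbT; apply/asboolP; exists h.
    by rewrite GLO_gcoset// -(ballE _ _ fB); case: Bh.
  have Kg := sK g gs; rewrite /gcoset /= => gh.
  rewrite -[h](mulKVmx (GLO_unit Kg)); apply: (GLOM hF) => //; exact: (Gam_GLO hF) gh.
exists (size s) => lam linv; rewrite KE measure_fin_bigcup; [|exact: finite_seq| |].
- rewrite -fsbig_seq ?undup_uniq// (eq_big_seq (fun=> lam (Gam val k))).
    by rewrite sume_const.
  by move=> g gs; apply: left_invariant_gcoset => //; exact/GLO_unit/sK.
- move=> g g' /= gs gs' [h []].
  have [B gE [Bg _]] := hs g gs; have [B' gE' [Bg' _]] := hs g' gs'.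
  rewrite !GLO_gcoset; [|exact: sK|exact: sK].
  move=> gh gh'; rewrite gE gE' /f.
  by rewrite (ballE B h (mball_trans hF Bg gh)) (ballE B' h (mball_trans hF Bg' gh')).
- by move=> g gs; apply: gcoset_measurable => //; exact/GLO_unit/sK.
Qed.

(** Cosets inside [GL] and truncated balls outside it: this family is closed under intersection, and
    its second kind is null for measures concentrated on [GL]. *)
Definition haar_pisystem : set (set MTn) :=
  [set A | [\/ A = set0, exists g k, [/\ g \in unitmx, (0 < k)%N & A = gcoset g k]
    | exists g k, A = mball val g k `\` GL F n]].

Lemma haar_pisystemI : setI_closed haar_pisystem.
Proof.
have coball g k g' l : g \in unitmx -> (0 < k)%N ->
    gcoset g k `&` (mball val g' l `\` GL F n) = set0.
  move=> gu k0; apply/seteqP; split=> // h [/(gcoset_unit k0 gu) hu [_]].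
  by rewrite /GL /=.
have coco g k g' l : g \in unitmx -> (0 < k)%N -> g' \in unitmx -> (0 < l)%N ->
    (k <= l)%N -> haar_pisystem (gcoset g k `&` gcoset g' l).
  move=> gu k0 gu' l0 kl.
  have [->|/set0P[h [gh gh']]] := eqVneq (gcoset g k `&` gcoset g' l) set0.
    by constructor 1.
  constructor 2; exists g', l; split=> //.
  rewrite (gcoset_eq k0 gu gh) (gcoset_eq l0 gu' gh'); apply/setIidPr.
  exact: gcoset_mono.
have baba g k g' l : k <= l -> haar_pisystem
    ((mball val g k `\` GL F n) `&` (mball val g' l `\` GL F n)).
  move=> kl.
  have -> : (mball val g k `\` GL F n) `&` (mball val g' l `\` GL F n) =
      (mball val g k `&` mball val g' l) `\` GL F n.
    by apply/seteqP; split=> [x [[? ?] [? ?]]|x [[? ?] ?]].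
  have [->|/set0P[h [gh gh']]] := eqVneq (mball val g k `&` mball val g' l) set0.
    by rewrite set0D; constructor 1.
  constructor 3; exists g', l; congr (_ `\` _); apply/setIidPr => x hx.
  apply: (mball_trans hF gh); apply: (mball_trans hF (mball_sym hF (mball_le kl gh'))).
  exact: mball_le hx.
move=> A B [->|[g [k [gu k0 ->]]]|[g [k ->]]] [->|[g' [l [gu' l0 ->]]]|[g' [l ->]]];
  rewrite ?set0I ?setI0; do ?[by constructor 1].
- case: (leqP k l) => kl; first exact: coco.
  by rewrite setIC; apply: coco => //; exact: ltnW.
- by rewrite coball//; constructor 1.
- by rewrite setIC coball//; constructor 1.
- case: (leP k l) => kl; first exact: baba.
  by rewrite setIC; apply: baba; exact: ltW.
Qed.

Lemma mball_measurable (g : 'M[F]_n) k : measurable (mball val g k : set MTn).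
Proof. by apply: sub_sigma_algebra; exists g, k. Qed.

Lemma haar_pisystem_measurable A : haar_pisystem A -> measurable A.
Proof.
move=> [->|[g [k [gu k0 ->]]]|[g [k ->]]] //.
  exact: gcoset_measurable.
by apply: measurableD; [exact: mball_measurable|exact: (measurable_GL hF)].
Qed.

Lemma haar_pisystem_gen : (measurable : set (set MTn)) = <<s haar_pisystem >>.
Proof.
apply/seteqP; split; last first.
  apply: smallest_sub; first exact: sigma_algebra_measurable.
  exact: haar_pisystem_measurable.
apply: smallest_sub; first exact: smallest_sigma_algebra.
move=> _ [g [k ->]].
change (measurable (mball val g k : set (g_sigma_algebraType haar_pisystem))).
rewrite -(setUIDK (mball val g k) (GL F n)); apply: measurableU; last first.
  by apply: sub_sigma_algebra; constructor 3; exists g, k.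
set U := _ `&` _; have [d hd] := mx_dense hF n.
(* The part of a ball inside [GL] is a countable union of cosets of dense points. *)
have -> : U = \bigcup_m \bigcup_l
   (if `[< d m \in unitmx /\ gcoset (d m) l.+1 `<=` U >] then gcoset (d m) l.+1 else set0).
  apply/seteqP; split=> [h [gh hu]|h [m _ [l _]]]; last by case: asboolP => // -[_]; apply.
  have [l l0 hl] := Gam_mball hF h `|k|%N; have [p hp] := mball_Gam hF l hu.
  have [m /hp hm] := hd h p; have mE : gcoset h l = gcoset (d m) l by exact: gcoset_eq.
  exists m => //; exists l.-1 => //; rewrite prednK//; case: asboolP => [_|[]].
    by rewrite -mE; exact: gcoset_refl.
  split; first exact: gcoset_unit hm.
  rewrite -mE => x hx; split; last exact: gcoset_unit hx.
  apply: (mball_trans hF gh); rewrite -[x](mulKVmx hu).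
  by apply: mball_le (hl _ hx); lia.
apply: bigcupT_measurable => m; apply: bigcupT_measurable => l.
case: asboolP => [[mu _]|_]; last exact: measurable0.
by apply: sub_sigma_algebra; constructor 2; exists (d m), l.+1.
Qed.

(** * Uniqueness of Haar measure and the right modulus *)

Section Uniqueness.
Variable mu : {measure set MTn -> \bar R}.
Hypothesis hmu : haar_on (GL F n) (GLO F val n) mu.

Let linv_mu : left_invariant (GL F n) mu.
Proof. exact: (haar_left_invariant GL_subgroup (@measurable_GL _ _ hF n) hmu). Qed.

(** Dividing by the common index determines both measures on every coset; measures that agree on a
    generating family closed under intersection, with a countable cover of finite measure,
    coincide. *)
Lemma haar_unique (lam : {measure set MTn -> \bar R}) (c : {nonneg R}) :
  left_invariant (GL F n) lam -> lam (~` GL F n) = 0%E ->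
  lam (GLO F val n) = (c%:num)%:E ->
  forall A, measurable A -> lam A = ((c%:num)%:E * mu A)%E.
Proof.
move=> linv lam0 lamc; have [mu0 _ mu1] := hmu.
have mGL := @measurable_GL _ _ hF n.
have Gamfin k : (0 < k)%N -> exists2 r : R, mu (Gam val k) = r%:E &
    lam (Gam val k) = (c%:num * r)%:E.
  move=> k0; have [N hN] := GLO_index k0.
  have N0 : (N%:R : R) != 0.
    apply/eqP => N0; have := hN mu linv_mu; rewrite mu1 N0 mul0e => /eqP.
    by rewrite eqe oner_eq0.
  have Npos : (0 < N%:R :> R) by rewrite lt0r N0 ler0n.
  have fin (nu : {measure set MTn -> \bar R}) (r : R) : nu (GLO F val n) = r%:E ->
      left_invariant (GL F n) nu -> nu (Gam val k) = (r / N%:R)%:E.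
    move=> nur inv; have := hN nu inv; rewrite nur.
    have : (0 <= nu (Gam val k))%E by exact: measure_ge0.
    case: (nu (Gam val k)) => [x| |]// _.
      by rewrite -EFinM => -[->]; rewrite mulrC mulKf.
    by rewrite mulry gtr0_sg// mul1e.
  exists (1 / N%:R); first exact: (fin mu 1 mu1 linv_mu).
  by rewrite (fin lam _ lamc linv) mul1r.
have [d hd] := mx_dense hF n.
pose cov (i : nat) : set MTn := if unpickle i is Some (b, m) then
  (if b then (if d m \in unitmx then gcoset (d m) 1 else set0)
   else mball val (d m) 0 `\` GL F n) else set0.
pose m1 : {measure set MTn -> \bar R} := mscale c mu.
have m1E A : m1 A = ((c%:num)%:E * mu A)%E by [].
have null (nu : {measure set MTn -> \bar R}) g k : nu (~` GL F n) = 0%E ->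
    nu (mball val g k `\` GL F n) = 0%E.
  move=> nu0; apply/eqP; rewrite eq_le measure_ge0 andbT -nu0; apply: le_measure.
  - by rewrite inE; apply: measurableD => //; exact: mball_measurable.
  - by rewrite inE; exact: measurableC.
  - by move=> x [].
have scal0 : m1 (~` GL F n) = 0%E.
  by rewrite m1E [X in (_ * X)%E](_ : _ = 0%E) ?mule0.
have agree A : haar_pisystem A -> m1 A = lam A.
  move=> [->|[g [k [gu k0 ->]]]|[g [k ->]]]; first by rewrite !measure0.
    have [r r1 r2] := Gamfin k k0.
    rewrite m1E (left_invariant_gcoset linv_mu k0 gu) (left_invariant_gcoset linv k0 gu).
    by rewrite r1 r2 -EFinM.
  by rewrite !null.
move=> A mA; have := @measure_unique _ R MTn haar_pisystem cov haar_pisystem_gen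
  haar_pisystemI _ _ m1 lam agree _ A mA.
rewrite m1E => -> //.
- move=> i; rewrite /cov; case: unpickle => [[[] m]|]; last by constructor 1.
    case: ifP => mu'; last by constructor 1.
    by constructor 2; exists (d m), 1%N.
  by constructor 3; exists (d m), 0.
- rewrite -subTset => g _; case: (boolP (g \in unitmx)) => gu.
    have [l hl] := mball_Gam hF 1 gu; have [m /hl hm] := hd g l.
    exists (pickle (true, m)) => //; rewrite /cov pickleK.
    have mu' : d m \in unitmx by exact: gcoset_unit hm.
    by rewrite mu' -(gcoset_eq _ gu hm)//; exact: gcoset_refl.
  have [m hm] := hd g 0%N; exists (pickle (false, m)) => //; rewrite /cov pickleK.
  by split; [exact: (mball_sym hF)|exact/negP].
- move=> i; rewrite /cov; case: unpickle => [[[] m]|]; last by rewrite measure0.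
    case: ifP => mu'; last by rewrite measure0.
    by rewrite m1E left_invariant_gcoset//; have [r -> _] := Gamfin 1%N isT; rewrite -EFinM ltry.
  by rewrite null.
Qed.

(** For invertible [g] this is the measure of [K g], with [K] the integral group; [rmodulusP] shows
    it finite, so that [fine] loses nothing. *)
Definition rmodulus (g : 'M[F]_n) : R :=
  fine (mu ((fun h : MTn => (h *m invmx g : MTn)) @^-1` GLO F val n)).

(** The pushforward of [mu] under a right translation is still left-invariant, so uniqueness makes
    it a multiple of [mu]. *)
Lemma rmodulusP g : g \in unitmx -> forall A, measurable A ->
  mu ((fun h : MTn => (h *m invmx g : MTn)) @^-1` A) = ((rmodulus g)%:E * mu A)%E.
Proof.
move=> gu; have [mu0 _ mu1] := hmu.
have mGL := @measurable_GL _ _ hF n.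
pose lam : {measure set MTn -> \bar R} :=
  measure_function_pushforward__canonical__measure_function_Measure mu
    (measurable_mulmxr hF (invmx g)).
have lamE A : lam A = mu ((fun h : MTn => (h *m invmx g : MTn)) @^-1` A) by [].
have linv : left_invariant (GL F n) lam.
  move=> h A hu mA; rewrite !lamE.
  rewrite -(linv_mu hu (measurable_preimage_mulmxr (invmx g) mA)).
  by congr (mu _); apply/seteqP; split=> x /=; rewrite mulmxA.
have lam0 : lam (~` GL F n) = 0%E.
  rewrite lamE -mu0; congr (mu _); apply/seteqP; split=> x /=; rewrite /GL /=.
    by rewrite unitmx_mul unitmx_inv gu andbT.
  by rewrite unitmx_mul unitmx_inv gu andbT.
(* [Kg^-1] contains a coset [g^-1 Gam k], whose [lam]-measure is at most [mu K = 1]. *)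
have lamfin : (lam (GLO F val n) < +oo)%E.
  pose B : set MTn := (fun h : MTn => (h *m g : MTn)) @^-1` GLO F val n.
  have mB : measurable B by apply: measurable_preimage_mulmxr; exact: GLO_measurable.
  have Bg : B (invmx g) by rewrite /B /= mulVmx//; exact: (GLO1 hF).
  have lamB : lam B = 1%E.
    rewrite lamE -mu1; congr (mu _); apply/seteqP; split=> x; rewrite /B /= mulmxKV//.
  have [k [k0 hk]] : exists k, (0 < k)%N /\ gcoset (invmx g) k `<=` B.
    have [a ha] := mvge_exists val g; have [b hb] := mvge_exists val (invmx g).
    exists (a + b).+1; split=> // x; rewrite /gcoset /= invmxK => hx.
    apply: (Gam_GLO hF (ltn0Sn 0)); rewrite /Gam /=.
    have -> : x *m g - 1%:M = invmx g *m (g *m x - 1%:M) *m g.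
      by rewrite mulmxBr mulmx1 mulKmx// mulmxBl mulVmx.
    by apply: mvge_le (mvgeM hF (mvgeM hF hb hx) ha); lia.
  have giu : invmx g \in unitmx by rewrite unitmx_inv.
  have [N hN] := GLO_index k0; rewrite (hN lam linv).
  rewrite -(left_invariant_gcoset linv k0 giu).
  have le1 : (lam (gcoset (invmx g) k) <= 1)%E.
    rewrite -lamB; apply: le_measure => //; rewrite inE//; exact: gcoset_measurable.
  apply: le_lt_trans (ltry (N%:R)); rewrite -[leRHS]mule1.
  by apply: lee_pmul => //; rewrite ?lee_fin.
have c0 : 0 <= fine (lam (GLO F val n)) by apply: fine_ge0; exact: measure_ge0.
have lamc : lam (GLO F val n) = ((NngNum c0)%:num)%:E.
  apply/esym/fineK; rewrite ge0_fin_numE; first exact: lamfin.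
  exact: measure_ge0.
by move=> A mA; have := haar_unique linv lam0 lamc mA.
Qed.

End Uniqueness.
End Haar.

Lemma haar_right_invariant (R : realType) (F : fieldType) (val : F -> int)
  (hF : nonarch_local_field val) n (mu : {measure set (MT val n.+1) -> \bar R}) :
  haar_on (GL F n.+1) (GLO F val n.+1) mu ->
  forall g (A : set (MT val n.+1)), g \in unitmx -> measurable A ->
  mu ((fun h : MT val n.+1 => (h *m g : MT val n.+1)) @^-1` A) = mu A.
Proof.
move=> hmu; have [mu0 _ mu1] := hmu.
have mK := @GLO_measurable _ _ hF n.+1.
have rmE g : g \in unitmx ->
    mu ((fun h : MT val n.+1 => (h *m invmx g : MT val n.+1)) @^-1` GLO F val n.+1) =
    (rmodulus mu g)%:E.
  by move=> gu; rewrite (rmodulusP hF hmu)// mu1 mule1.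
have pc : positive_character val (rmodulus mu).
  split.
  - by move=> g; apply: fine_ge0; exact: measure_ge0.
  - move=> g h gu hu; have ghu : g *m h \in unitmx by rewrite unitmx_mul gu.
    apply: EFin_inj; rewrite -(rmE _ ghu) mulrC EFinM -(rmE g)//.
    rewrite -(rmodulusP hF hmu hu); last exact: measurable_preimage_mulmxr.
    congr (mu _); apply/seteqP; split=> x /=; by rewrite invmx_mul// mulmxA.
  - move=> g Kg; apply: EFin_inj; rewrite -rmE; last exact: (GLO_unit Kg).
    rewrite -mu1; congr (mu _); apply/seteqP; split=> x /= Kx.
      by rewrite -[x](mulmxKV (GLO_unit Kg)); exact: (GLOM hF).
    by apply: (GLOM hF) => //; exact: (GLOV hF).
  (* Scalars are central, so this right translation is also a left one. *)
  - move=> a a0; apply: EFin_inj.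
    have au : (a%:M : 'M[F]_n.+1) \in unitmx.
      by rewrite unitmx_det0 det_scalar expf_neq0.
    rewrite -rmE// -mu1.
    have linv := haar_left_invariant hF (GL_subgroup F n.+1) (@measurable_GL _ _ hF n.+1) hmu.
    rewrite -(linv (invmx a%:M) _ _ mK); last by rewrite /GL /= unitmx_inv.
    by congr (mu _); apply/seteqP; split=> x /=; rewrite invmx_scalar scalar_mxC.
move=> g A gu mA; have giu : invmx g \in unitmx by rewrite unitmx_inv.
have := rmodulusP hF hmu giu mA; rewrite invmxK => ->.
by rewrite (positive_character_trivial hF pc)// mul1e.
Qed.

(** * The commutant of a regular semisimple matrix *)

Lemma horner_mx_sum (R : comNzRingType) n (A : 'M[R]_n.+1) (p : {poly R}) :
  horner_mx A p = \sum_(i < size p) p`_i *: A ^+ i.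
Proof.
rewrite -[p in LHS]coefK poly_def linear_sum; apply: eq_bigr => i _.
by rewrite linearZ /= rmorphXn /= horner_mx_X.
Qed.

Section Commutant.
Variables (F : fieldType) (n : nat) (x : 'M[F]_n.+1).
Hypothesis hx : Delta x != 0.

Definition commutant : set 'M[F]_n.+1 := [set g | g * x = x * g].
Local Notation chi := (char_poly x).

Lemma char_poly_coprime_deriv : coprimep chi chi^`().
Proof.
move: hx; rewrite /Delta mulf_eq0 signr_eq0 /= resultant_eq0 -leqNgt coprimep_def => h.
rewrite eqn_leq h lt0n size_poly_eq0 gcdp_eq0 negb_and; apply/orP; left.
exact/monic_neq0/char_poly_monic.
Qed.

(* The coefficient of [eps] in the Cayley-Hamilton identity for [x + eps g]. *)
Lemma commutant_deriv g : commutant g ->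
  exists p, g * horner_mx x chi^`() = horner_mx x p.
Proof.
move=> gx; pose A : 'M[{poly F}]_n.+1 := map_mx polyC x + 'X *: map_mx polyC g.
pose ev i (M : 'M[{poly F}]_n.+1) : 'M[F]_n.+1 := map_mx (coefp i) M.
have evM0 M N : ev 0 (M * N) = ev 0 M * ev 0 N.
  by rewrite /ev -!mulmxE map_mxM.
have evM1 M N : ev 1 (M * N) = ev 1 M * ev 0 N + ev 0 M * ev 1 N.
  apply/matrixP => i j; rewrite -!mulmxE !mxE /= coef_sum -big_split /=.
  by apply: eq_bigr => k _; rewrite coefM !big_ord_recr big_ord0 /= !mxE /= add0r addrC.
have A0 : ev 0 A = x by apply/matrixP => i j; rewrite !mxE /= coefD coefC coefXM addr0.
have A1 : ev 1 A = g by apply/matrixP => i j; rewrite !mxE /= coefD coefC coefXM coefC add0r.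
(* As [g] commutes with [x], the first-order term of the [k]-th power is [k g x^(k-1)]; this is how
   the derivative of [chi] emerges. *)
have AX k : ev 0 (A ^+ k) = x ^+ k /\ ev 1 (A ^+ k) = (g * x ^+ k.-1) *+ k.
  elim: k => [|k [IH0 IH1]].
    split; rewrite !expr0; first by apply/matrixP => i j; rewrite !mxE /= coefMn coef1.
    by apply/matrixP => i j; rewrite !mxE /= coefMn coef1 mul0rn.
  split; first by rewrite exprS evM0 IH0 A0 -exprS.
  rewrite exprS evM1 IH0 IH1 A0 A1 /= [RHS]mulrS; congr (_ + _).
  case: k {IH0 IH1} => [|k]; first by rewrite !mulr0n mulr0.
  by rewrite mulrnAr mulrA -gx -mulrA -exprS.
pose Q := char_poly A.
have Q0 i : (Q`_i)`_0 = chi`_i.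
  have := map_char_poly (coefp 0 : {rmorphism {poly F} -> F}) A.
  rewrite -/(ev 0 A) A0 => <-; by rewrite coef_map.
exists (- \poly_(i < size Q) (Q`_i)`_1).
have := Cayley_Hamilton A; rewrite horner_mx_sum -/Q => /(congr1 (ev 1)).
have -> : ev 1 0 = 0 by apply/matrixP => i j; rewrite !mxE /= coef0.
have -> : ev 1 (\sum_(i < size Q) Q`_i *: A ^+ i) =
    \sum_(i < size Q) (Q`_i)`_0 *: ev 1 (A ^+ i) + \sum_(i < size Q) (Q`_i)`_1 *: ev 0 (A ^+ i).
  etransitivity; last exact: big_split.
  rewrite /ev raddf_sum; apply: eq_bigr => i _; apply/matrixP => p q.
  by rewrite !mxE /= coefM !big_ord_recr big_ord0 /= add0r subn0 subnn.
move=> /eqP; rewrite addr_eq0 => /eqP E.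
rewrite rmorphN /=.
have -> : horner_mx x (\poly_(i < size Q) (Q`_i)`_1) =
    \sum_(i < size Q) (Q`_i)`_1 *: ev 0 (A ^+ i).
  rewrite poly_def linear_sum; apply: eq_bigr => i _.
  by rewrite linearZ /= rmorphXn /= horner_mx_X (AX i).1.
rewrite -E; have -> : chi^`() = \sum_(i < size Q) ((Q`_i)`_0 *+ i) *: 'X^(i.-1).
  rewrite -[chi]coefK poly_def raddf_sum /=.
  have -> : size chi = size Q by rewrite !size_char_poly.
  apply: eq_bigr => i _; rewrite derivZ derivXn Q0.
  by rewrite -scalerMnr -scalerMnl.
rewrite linear_sum mulr_sumr; apply: eq_bigr => i _.
rewrite linearZ /= rmorphXn /= horner_mx_X (AX i).2.
by rewrite -scalerAr -scalerMnl -scalerMnr.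
Qed.

(** By Bezout and Cayley-Hamilton [v(x)] inverts the derivative of [chi] at [x], so the identity of
    [commutant_deriv] can be solved for [g]. *)
Lemma commutant_poly g : commutant g -> exists p, g = horner_mx x p.
Proof.
move=> gx; have /Bezout_eq1_coprimepP[[u v] /= uv1] := char_poly_coprime_deriv.
have [p hp] := commutant_deriv gx; exists (p * v).
have := congr1 (horner_mx x) uv1; rewrite rmorphD !rmorphM /= Cayley_Hamilton mulr0 add0r.
rewrite rmorph1 => E; rewrite -hp -mulrA.
have -> : horner_mx x chi^`() * horner_mx x v = 1 by rewrite -E; exact: comm_horner_mx2.
by rewrite mulr1.
Qed.

Lemma horner_commutant p : commutant (horner_mx x p).
Proof. by rewrite /commutant /= -{2 3}(horner_mx_X x); exact: comm_horner_mx2. Qed.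

Lemma commutantC g h : commutant g -> commutant h -> g * h = h * g.
Proof. by move=> /commutant_poly[p ->] /commutant_poly[q ->]; exact: comm_horner_mx2. Qed.

Lemma commutant1 : commutant 1.
Proof. by rewrite /commutant /= mul1r mulr1. Qed.
Lemma commutantD g h : commutant g -> commutant h -> commutant (g + h).
Proof. by rewrite /commutant /= mulrDl mulrDr => -> ->. Qed.
Lemma commutantN g : commutant g -> commutant (- g).
Proof. by rewrite /commutant /= mulNr mulrN => ->. Qed.
Lemma commutantM g h : commutant g -> commutant h -> commutant (g * h).
Proof. by rewrite /commutant /= => gx hx'; rewrite -mulrA hx' mulrA gx mulrA. Qed.
Lemma commutantZ c g : commutant g -> commutant (c *: g).
Proof. by rewrite /commutant /= -scalerAl -scalerAr => ->. Qed.

(** * Primitive idempotents of the commutant and their fields *)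

Record primitive_idempotent (e : 'M[F]_n.+1) : Prop := {
  pi_comm : commutant e;
  pi_idem : e * e = e;
  pi_neq0 : e != 0;
  pi_min : forall f, commutant f -> f * f = f -> f * e = f -> f = 0 \/ f = e }.

(** Write [c e = p(x)]. The minimal polynomial [m] is squarefree, so [d = gcd(m, p)] is coprime to
    [m / d], and Bezout yields an idempotent [f] below [e] generating the same ideal as [c e].
    Minimality forces [f = e], and expressing [f] as a multiple of [c e] exhibits the inverse. *)
Lemma primitive_idempotent_field e : primitive_idempotent e ->
  forall c, commutant c -> c * e != 0 -> exists2 c', commutant c' & c * c' * e = e.
Proof.
move=> he c cx ce0; have ex := pi_comm he.
have [p pE] := commutant_poly (commutantM cx ex).
pose m := mxminpoly x; pose d := gcdp m p; pose q := m %/ d.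
have mE : q * d = m by rewrite divpK// dvdp_gcdl.
have sepm : separable_poly m.
  apply: dvdp_separable (mxminpoly_dvd_char x) _.
  by rewrite unlock; exact: char_poly_coprime_deriv.
have /Bezout_eq1_coprimepP[[u v] /= uv1] : coprimep q d.
  by apply: separable_coprime sepm _; rewrite mE.
have [[u1 u2] /= /andP[/dvdpP[s dE] _]] := Bezoutp m p.
have mx0 : horner_mx x m = 0 by exact: mx_root_minpoly.
have dx : horner_mx x d = horner_mx x (s * u2) * (c * e).
  rewrite /d dE pE -rmorphM (_ : s * _ = s * u1 * m + s * u2 * p); last by ring.
  by rewrite rmorphD /= [X in X + _]rmorphM /= mx0 mulr0 add0r.
pose f := horner_mx x (v * d).
have fx : commutant f by exact: horner_commutant.
have f1 : 1 - f = horner_mx x (u * q).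
  by rewrite /f -(rmorph1 (horner_mx x)) -uv1 rmorphD /= addrK.
have ff : f * f = f.
  apply/eqP; rewrite -subr_eq0 -[X in _ - X]mulr1 -mulrBr -oppr_eq0 -mulrN opprB f1.
  rewrite -rmorphM (_ : v * d * (u * q) = (u * v) * (q * d)); last by ring.
  by rewrite mE rmorphM /= mx0 mulr0.
have fE : f = horner_mx x (v * (s * u2)) * c * e.
  by rewrite /f !rmorphM /= dx !rmorphM /= !mulrA.
have fe : f * e = f by rewrite fE -mulrA (pi_idem he).
have [f0|fe'] := pi_min he fx ff fe.
  case/eqP: ce0; rewrite pE.
  have d0 : horner_mx x d = 0.
    have := congr1 (horner_mx x) uv1; rewrite rmorphD /= -/f f0 addr0 rmorph1 => E.
    by rewrite -[LHS]mul1r -E -rmorphM -mulrA mE rmorphM /= mx0 mulr0.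
  have /dvdpP[r ->] : d %| p by exact: dvdp_gcdr.
  by rewrite rmorphM /= d0 mulr0.
exists (horner_mx x (v * (s * u2))); first exact: horner_commutant.
by rewrite -[RHS]fe' fE (commutantC cx (horner_commutant _)).
Qed.

(** The row spaces of [f] and [e - f] lie in that of [e] and meet trivially. Rank thus decreases
    along a proper splitting and bounds the number of summands. *)
Lemma mxrank_idempotent_split (e f : 'M[F]_n.+1) : e * e = e -> f * f = f ->
  f * e = f -> e * f = f -> (\rank f + \rank (e - f)%R <= \rank e)%N.
Proof.
move=> ee ff fe ef; rewrite -mxrank_disjoint_sum.
  apply: mxrankS; rewrite addsmx_sub; apply/andP; split.
    by rewrite -{1}fe; exact: submxMl.
  have -> : e - f = (e - f) *m e by rewrite mulmxE mulrBl ee fe.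
  exact: submxMl.
apply/eqP; rewrite -submx0; apply/rV_subP => v; rewrite sub_capmx => /andP[].
move=> /submxP[a ->] /submxP[b E].
have -> : a *m f = 0; last exact: sub0mx.
have -> : a *m f = a *m f *m f by rewrite -mulmxA mulmxE ff.
by rewrite E -mulmxA mulmxE mulrBl ef ff subrr mulmx0.
Qed.

Lemma idempotent_decomposition e : commutant e -> e * e = e ->
  exists s : seq 'M[F]_n.+1, [/\ (size s <= \rank e)%N,
    forall f, f \in s -> primitive_idempotent f & \sum_(f <- s) f = e].
Proof.
move: {2}(\rank e) (leqnn (\rank e)) => k; elim: k e => [|k IH] e ek ex ee.
  exists [::]; split=> //; rewrite big_nil; apply/esym/eqP.
  by rewrite -mxrank_eq0 -leqn0.
have [->|e0] := eqVneq e 0; first by exists [::]; split=> //; rewrite big_nil.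
case: (pselect (primitive_idempotent e)) => [he|nhe].
  exists [:: e]; split; first by rewrite lt0n mxrank_eq0.
    by move=> f; rewrite inE => /eqP ->.
  by rewrite big_seq1.
have [f [fx ff fe [f0 fne]]] : exists f, [/\ commutant f, f * f = f, f * e = f &
    f <> 0 /\ f <> e].
  apply: contrapT => H; apply: nhe; split=> // f fx ff fe.
  apply: contrapT => /not_orP[f0 fne]; apply: H; by exists f.
have ef : e * f = f by rewrite (commutantC ex fx).
have gx : commutant (e - f) by apply: commutantD => //; exact: commutantN.
have gg : (e - f) * (e - f) = e - f.
  by rewrite mulrBr !mulrBl ee fe ef ff subrr subr0.
have rk := mxrank_idempotent_split ee ff fe ef.
have rf : (0 < \rank f)%N by rewrite lt0n mxrank_eq0; exact/eqP.
have rg : (0 < \rank (e - f)%R)%N.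
  by rewrite lt0n mxrank_eq0 subr_eq0; apply/eqP => /esym.
have [s1 [h1 h2 h3]] := IH f ltac:(lia) fx ff.
have [s2 [k1 k2 k3]] := IH (e - f) ltac:(lia) gx gg.
exists (s1 ++ s2); split; first by rewrite size_cat; lia.
  by move=> g; rewrite mem_cat => /orP[/h2|/k2].
by rewrite big_cat /= h3 k3 addrC subrK.
Qed.

End Commutant.

(** * Counting cosets in the torus *)

Section TorusCount.
Variables (F : fieldType) (val : F -> int).
Hypothesis hF : nonarch_local_field val.
Variables (n : nat) (x : 'M[F]_n.+1).
Hypothesis hx : Delta x != 0.
Local Notation mvge := (mvge val).
Local Notation E := (commutant x).
Local Notation T := (centralizer x).

Lemma centralizer_subgroup : mx_subgroup T.
Proof.
split=> [g [] //||g h [gu gx] [hu hx']|g [gu gx]].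
- by split; [exact: unitmx1|rewrite mul1mx mulmx1].
- by split; [rewrite unitmx_mul gu|rewrite -mulmxA hx' mulmxA gx mulmxA].
- split; first by rewrite unitmx_inv.
  by rewrite -[RHS](mulKmx gu) [g *m _]mulmxA gx mulmxK.
Qed.

Lemma centralizerC g h : T g -> T h -> g *m h = h *m g.
Proof. by move=> [_ gx] [_ hx']; exact: (commutantC hx gx hx'). Qed.

Lemma mpowE (g : 'M[F]_n.+1) k : mpow g k = g ^+ k.
Proof. by elim: k => [|k IH]; rewrite ?expr0// exprS -IH. Qed.

Lemma centralizerX g k : T g -> T (g ^+ k).
Proof.
move=> Tg; elim: k => [|k IH]; first by rewrite expr0; exact: (msg1 centralizer_subgroup).
by rewrite exprS; exact: (msgM centralizer_subgroup).
Qed.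

(** Acts as [t] on the summand cut out by [e] and as the identity on its complement, so its
    determinant is that of [t] on the image of [e]. *)
Definition block (e t : 'M[F]_n.+1) := t * e + (1 - e).
Definition bval (e t : 'M[F]_n.+1) := val (\det (block e t)).

Lemma commutant_frequently (u : nat -> 'M[F]_n.+1) l :
  (forall m, E (u m)) -> (forall k : nat, frequently [set m | mvge (u m - l) k%:Z]) -> E l.
Proof.
move=> uE ul; apply/eqP; rewrite -subr_eq0; apply/eqP; apply: (@mvge_all _ val) => k.
have [a ha] := mvge_exists val x; have [m _ /= hm] := ul (k + a)%N 0%N.
have -> : l * x - x * l = x * (u m - l) - (u m - l) * x.
  by rewrite mulrBl mulrBr (uE m) opprB [RHS]addrC addrA subrK.
by apply: (mvgeB hF); [apply: mvge_le (mvgeM hF ha hm)|apply: mvge_le (mvgeM hF hm ha)]; lia.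
Qed.

Section Primitive.
Variable e : 'M[F]_n.+1.
Hypothesis he : primitive_idempotent x e.

Let ee : e * e = e. Proof. exact: (pi_idem he). Qed.
Let ex : E e. Proof. exact: (pi_comm he). Qed.

Lemma idem_compl : (1 - e) * (1 - e) = 1 - e.
Proof. by rewrite mulrBr mulr1 mulrBl mul1r ee subrr subr0. Qed.
Lemma idem_compl0 : e * (1 - e) = 0.
Proof. by rewrite mulrBr mulr1 ee subrr. Qed.
Lemma compl_idem0 : (1 - e) * e = 0.
Proof. by rewrite mulrBl mul1r ee subrr. Qed.

Lemma blockM t s : E t -> E s -> block e (t * s) = block e t * block e s.
Proof.
move=> tx sx; move: idem_compl idem_compl0 compl_idem0; rewrite /block.
move: (1 - e) => f ff ef fe; rewrite mulrDl !mulrDr ff.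
have -> : t * e * (s * e) = t * s * e.
  by rewrite -mulrA (mulrA e) (commutantC hx ex sx) -(mulrA s) ee mulrA.
have -> : t * e * f = 0 by rewrite -mulrA ef mulr0.
have -> : f * (s * e) = 0 by rewrite (commutantC hx sx ex) mulrA fe mul0r.
by rewrite addr0 add0r.
Qed.

Lemma block1 : block e 1 = 1. Proof. by rewrite /block mul1r addrC subrK. Qed.

Lemma blockV t s : E t -> E s -> t * s * e = e -> block e t \in unitmx.
Proof.
move=> tx sx tse; apply: (proj1 (mulmx1_unit (B := block e s) _)).
by rewrite mulmxE -blockM// /block tse addrC subrK.
Qed.

Lemma block_unit t : T t -> block e t \in unitmx.
Proof.
move=> Tt; have [tu tx] := Tt; have [_ tx'] := msgV centralizer_subgroup Tt.
by apply: (blockV tx tx'); rewrite -mulmxE mulmxV// mul1mx.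
Qed.

Lemma bvalM t s : T t -> T s -> bval e (t *m s) = bval e t + bval e s.
Proof.
move=> Tt Ts; have [_ tx] := Tt; have [_ sx] := Ts.
by rewrite /bval mulmxE blockM// -mulmxE (val_det_mul hF) ?block_unit.
Qed.

Lemma bval1 : bval e 1 = 0. Proof. by rewrite /bval block1 det1 (nval1 hF). Qed.

Lemma bvalX t k : T t -> bval e (t ^+ k) = bval e t *+ k.
Proof.
move=> Tt; elim: k => [|k IH]; first by rewrite expr0 mulr0n bval1.
by rewrite exprS mulrS -IH -bvalM//; exact: centralizerX.
Qed.

Lemma bvalV t : T t -> bval e (invmx t) = - bval e t.
Proof.
move=> Tt; have [tu _] := Tt; have := bvalM (msgV centralizer_subgroup Tt) Tt.
by rewrite mulVmx// bval1 => h; lia.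
Qed.

(* By compactness: a limit of primitive vectors of the field [e E] with
   determinants tending to [0] would be a nonzero non-invertible element. *)
Lemma primitive_bval_bounded : exists X : nat, forall a, E a -> a * e = a ->
  mvge a 0 -> ~ mvge a 1 -> bval e a <= X%:Z.
Proof.
apply: contrapT => /forallNP H.
have {}H (X : nat) : exists a, [/\ E a, a * e = a, mvge a 0, ~ mvge a 1 & X%:Z < bval e a].
  have /existsNP[a /not_implyP[aE /not_implyP[ae /not_implyP[a0 /not_implyP[a1 aX]]]]] := H X.
  by exists a; split=> //; rewrite ltNge; apply/negP.
have [u hu] := choice H.
have u0 m : mvge (u m) (- 0%N%:Z) by have [_ _ + _ _] := hu m; rewrite oppr0.
have [l hl] := mx_bolzano hF u0.
have lE : E l by apply: commutant_frequently hl => m; have [] := hu m.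
have le : l * e = l.
  apply/eqP; rewrite -subr_eq0; apply/eqP; apply: (@mvge_all _ val) => k.
  have [a ha] := mvge_exists val e; have [m _ /= hm] := hl (k + a)%N 0%N.
  have [_ ue _ _ _] := hu m.
  have -> : l * e - l = (u m - l) - (u m - l) * e.
    by rewrite mulrBl ue opprB [RHS]addrC addrA subrK.
  by apply: (mvgeB hF); [apply: mvge_le hm|apply: mvge_le (mvgeM hF hm ha)]; lia.
have l0 : l * e != 0.
  apply/eqP => l0; have [m _ /= hm] := hl 1%N 0%N; have [_ _ _ + _] := hu m; apply.
  by move: hm; rewrite -le l0 subr0.
have [c cE lc] := primitive_idempotent_field hx he lE l0.
have Lu : block e l \in unitmx by exact: blockV lc.
(* Take [m] past the absolute value of [bval e l], with [u m] so close to [l] that the two blocks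
   differ by an element of [GL_n(O_F)]. Their values then agree, against [bval e (u m) > m]. *)
have [k hk] := mball_Gam hF 1 Lu.
have [m mN /= hm] := hl k `|bval e l|%N; have [_ ue _ _ um] := hu m.
have /hk/(Gam_GLO hF (ltn0Sn 0))[_ [d0 dv]] : mball val (block e l) k%:Z (block e (u m)).
  apply/mballE; have -> : block e (u m) - block e l = u m - l; last exact: hm.
  by rewrite /block ue le opprD addrACA subrr addr0.
have : val (\det (block e (u m))) = bval e l.
  rewrite -[block e (u m)](mulKVmx Lu) (val_det_mul hF)// ?dv ?addr0//.
  by rewrite unitmx_det0.
rewrite -/(bval _ _) => vE; move: um mN; rewrite vE; move: (bval e l) => v; lia.
Qed.

Lemma scalar_commutant (c : F) : E c%:M.
Proof. by rewrite /commutant /= -mulmxE scalar_mxC. Qed.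

Lemma scalar_centralizer (c : F) : c != 0 -> T c%:M.
Proof.
by move=> c0; split; [rewrite unitmx_det0 det_scalar expf_neq0|exact: scalar_commutant].
Qed.

(* Otherwise [p^k e + 1 - e] would have bounded inverses [p^-k e + 1 - e]. *)
Lemma bval_scalar_gt0 (c : F) : c != 0 -> val c = 1 -> 0 < bval e c%:M.
Proof.
move=> c0 vc; rewrite ltNge; apply/negP => h.
have [a ha] := mvge_exists val e; have [b hb] := mvge_exists val (1 - e).
have Tc := scalar_centralizer c0; have Tc' := msgV centralizer_subgroup Tc.
case/eqP: (pi_neq0 he); apply: (@mvge_all _ val) => k.
(* [N] pays for the adjugate, of degree [n] in the entries, and for the entries of [1 - e], with [k]
   to spare. *)
pose N := (k + b + (a + b) * n)%N.
have bl : mvge (block e (c%:M ^+ N)) (- (a + b)%N%:Z).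
  apply: (mvgeD hF); last by apply: mvge_le hb; lia.
  rewrite -rmorphXn /= -mulmxE mul_scalar_mx.
  apply: (@mvge_le _ _ _ _ (0 + - a%:Z)); first by lia.
  apply: (mvgeZ hF) => //.
  by rewrite vge_val ?expf_neq0// (valX hF)// vc natz.
have Tcn := centralizerX N Tc.
have du := block_unit Tcn.
have dv : val (\det (block e (c%:M ^+ N))) <= 0.
  by rewrite -/(bval _ _) bvalX//; move: h; set v := bval _ _ => h; rewrite -mulr_natr natz; nia.
have := mvge_inv hF du bl dv.
have -> : invmx (block e (c%:M ^+ N)) = block e ((c^-1 ^+ N)%:M).
  apply: (can_inj (mulKmx du)); rewrite mulmxV// mulmxE -blockM.
  - rewrite -rmorphXn /= -mulmxE mul_scalar_mx scale_scalar_mx exprVn divff ?expf_neq0//.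
    by rewrite block1.
  - by case: Tcn.
  - exact: scalar_commutant.
rewrite /= /block => hV.
have -> : e = c ^+ N *: ((c^-1 ^+ N)%:M * e + (1 - e) - (1 - e)).
  by rewrite addrK -mulmxE mul_scalar_mx scalerA exprVn divff ?expf_neq0// scale1r.
apply: (@mvge_le _ _ _ _ (N%:Z + - ((a + b) * n + b)%N%:Z)); first by rewrite /N; lia.
apply: (mvgeZ hF).
  by rewrite vge_val ?expf_neq0// (valX hF)// vc natz.
apply: (mvgeB hF); last by apply: mvge_le hb; lia.
by apply: mvge_le hV; rewrite mulNrn -mulr_natr natz; lia.
Qed.

(** If clearing the denominators of [t * e] took [p ^+ m] with [m > X], the resulting primitive
    vector would have value at least [m], since [p] itself has value at least 1. This contradicts
    the bound [X] for primitive vectors. *)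
Lemma bval_ge0_bounded : exists C : nat, forall t, T t -> 0 <= bval e t ->
  mvge (t * e) (- C%:Z).
Proof.
have [X hX] := primitive_bval_bounded; exists X => t Tt vt.
have [tu tx] := Tt; have ax := commutantM tx ex.
have [p [p0 vp]] := nlf_unif hF.
have bp := bval_scalar_gt0 p0 vp.
apply: contrapT => na.
have [k0 hk0] := mvge_exists val (t * e).
have Xk : (X < k0)%N.
  rewrite ltnNge; apply/negP => kX; apply: na; apply: mvge_le hk0; lia.
(* The guard [j + X < k0] keeps [m = k0 - j] above [X]. At the maximal [j] the exponent [m - 1] does
   not suffice: by maximality, or by [na] when the guard blocks the next step. *)
have exj : exists j, `[< mvge (t * e) (- (k0 - j)%N%:Z) /\ (j + X < k0)%N >].
  by exists 0%N; apply/asboolP; rewrite subn0.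
have bj j : `[< mvge (t * e) (- (k0 - j)%N%:Z) /\ (j + X < k0)%N >] -> (j <= k0)%N.
  by move=> /asboolP[_]; lia.
case: (ex_maxnP exj bj) => j /asboolP[hj jX] jmax.
pose m := (k0 - j)%N.
have nm : ~ mvge (t * e) (- m%:Z + 1).
  move=> h; case: (ltnP (j.+1 + X) k0) => jk.
    suff : (j.+1 <= j)%N by rewrite ltnn.
    apply: jmax; apply/asboolP; split=> //.
    by apply: mvge_le h; rewrite /m; lia.
  by apply: na; apply: mvge_le h; rewrite /m; lia.
pose a := p ^+ m *: (t * e).
have vpm : val (p ^+ m) = m%:Z by rewrite (valX hF)// vp natz.
have pm0 : p ^+ m != 0 by rewrite expf_neq0.
have a0 : mvge a 0.
  apply: (@mvge_le _ _ _ _ (m%:Z + - m%:Z)); first by rewrite subrr.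
  by apply: (mvgeZ hF) => //; rewrite vge_val// vpm.
have a1 : ~ mvge a 1.
  move=> h; apply: nm; have -> : t * e = (p ^+ m)^-1 *: a.
    by rewrite scalerA mulVf// scale1r.
  by apply: (mvgeZ hF) => //; rewrite vge_val ?invr_eq0// (valV hF)// vpm.
have aE : E a by exact: commutantZ.
have ae : a * e = a by rewrite /a -scalerAl -mulrA ee.
have := hX a aE ae a0 a1.
have -> : bval e a = bval e (p%:M ^+ m * t).
  congr (val (\det (_ + _))); rewrite ae /a -rmorphXn /= -mulrA.
  by rewrite -!mulmxE mul_scalar_mx.
have Tp := scalar_centralizer p0.
have -> : bval e (p%:M ^+ m * t) = bval e p%:M *+ m + bval e t.
  by rewrite -mulmxE bvalM ?bvalX//; exact: centralizerX.
rewrite -mulr_natr natz; move: bp vt; set u := bval e p%:M; set v := bval e t => bp vt.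
have : (X < m)%N by rewrite /m; lia.
by nia.
Qed.

Lemma bval_lower t (j : nat) : T t -> mvge t (- j%:Z) -> - (n.+1 * j)%N%:Z <= bval e t.
Proof.
move=> Tt tj; have [a ha] := mvge_exists val e; have [b hb] := mvge_exists val (1 - e).
have tX k : mvge (t ^+ k) (- (k * j)%N%:Z).
  elim: k => [|k IH]; first by rewrite expr0 mul0n oppr0; exact: (mvge1 hF).
  by rewrite exprS; apply: mvge_le (mvgeM hF tj IH); lia.
(* One more than the cost of [e] and [1 - e]: after division by [k] the error is below 1, and
   integrality removes it. *)
pose k := (n.+1 * (a + b)).+1.
have : vge val (\det (block e (t ^+ k))) ((- (k * j + (a + b))%N%:Z) *+ n.+1).
  apply: (vge_det hF); apply: (mvgeD hF); last by apply: mvge_le hb; lia.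
  by apply: mvge_le (mvgeM hF (tX k) ha); lia.
have Ttk := centralizerX k Tt; rewrite vge_val -?unitmx_det0 ?block_unit//.
rewrite -/(bval _ _) bvalX// -[_ *+ n.+1]mulr_natr -[_ *+ k]mulr_natr !natz.
move: (bval e t) => v h; rewrite leNgt; apply/negP => lt.
have {}lt : v <= - (n.+1 * j)%N%:Z - 1 by lia.
have : v * k%:Z <= (- (n.+1 * j)%N%:Z - 1) * k%:Z by rewrite ler_pM2r.
by rewrite /k in h *; nia.
Qed.

End Primitive.

Lemma bval_range e t (j : nat) : primitive_idempotent x e -> T t -> Gi F val n.+1 j t ->
  - (n.+1 * j)%N%:Z <= bval e t <= (n.+1 * (n.+1 * j))%N%:Z.
Proof.
move=> he Tt tj; have [_ /(ovG_le)[t1 _]] := tj; rewrite bval_lower//=.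
have [_ /(ovG_le)[t2 _]] := GiV hF (ltn0Sn n) tj.
have := bval_lower he (msgV centralizer_subgroup Tt) t2; rewrite bvalV//; lia.
Qed.

(** All powers of [t] have value 0 on every block, so one bound serves every [t ^+ k * e], and
    summing over the idempotents bounds the entries. Upper bounds on determinants come from the
    powers of the inverse. *)
Lemma maxcpt_bval (s : seq 'M[F]_n.+1) t :
  (forall e, e \in s -> primitive_idempotent x e) -> \sum_(e <- s) e = 1 ->
  T t -> (forall e, e \in s -> bval e t = 0) -> maxcpt val T t.
Proof.
move=> hs s1 Tt vt; split=> //.
have hC (e : 'M[F]_n.+1) : exists C : nat, primitive_idempotent x e ->
    forall t, T t -> 0 <= bval e t -> mvge (t * e) (- C%:Z).
  case: (pselect (primitive_idempotent x e)) => [he|nhe]; last by exists 0%N.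
  by have [C hC] := bval_ge0_bounded he; exists C.
have [C {}hC] := choice hC.
pose D := (\max_(e <- s) C e)%N.
have bnd u k : T u -> (forall e, e \in s -> bval e u = 0) -> mvge (u ^+ k) (- D%:Z).
  move=> Tu vu; rewrite -[u ^+ k]mulr1 -s1 mulr_sumr; apply: (mvge_seq_sum hF) => e es.
  have /hC := hs e es => H; apply: mvge_le (H (u ^+ k) _ _).
  - have : (C e <= D)%N by rewrite /D; exact: leq_bigmax_seq.
    by lia.
  - exact: centralizerX.
  - by rewrite bvalX ?vu ?mul0rn//; exact: hs.
have Tt' := msgV centralizer_subgroup Tt.
have vt' e : e \in s -> bval e (invmx t) = 0.
  by move=> es; rewrite bvalV ?vt ?oppr0//; exact: hs.
have det u k : T u -> (forall e, e \in s -> bval e u = 0) ->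
    - (D * n.+1)%N%:Z <= val (\det (u ^+ k)).
  move=> Tu vu; have := vge_det hF (bnd u k Tu vu).
  have [uk _] := centralizerX k Tu; rewrite vge_val -?unitmx_det0//.
  by rewrite mulNrn -mulr_natr natz; lia.
have tV k : val (\det (t ^+ k)) = - val (\det (invmx t ^+ k)).
  have [tu _] := Tt; rewrite -(val_det_inv hF); last by case: (centralizerX k Tt').
  congr (val (\det _)).
  have tkV : t ^+ k *m invmx t ^+ k = 1%:M.
    elim: k => [|k IH]; first by rewrite !expr0 mulmx1.
    rewrite exprSr exprS -!mulmxE -mulmxA (mulmxA t) mulmxV// mul1mx; exact: IH.
  have uk : invmx t ^+ k \in unitmx by case: (centralizerX k Tt').
  by rewrite -[LHS](mulmxK uk) tkV mul1mx.
exists (D + D * n.+1)%N%:Z => k; rewrite !mpowE; split; apply/ovG_le; split.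
- by apply: mvge_le (bnd t k Tt vt); lia.
- by rewrite tV; move: (det (invmx t) k Tt' vt'); move: (val _) => v; lia.
- by apply: mvge_le (bnd (invmx t) k Tt' vt'); lia.
- by move: (det t k Tt vt); rewrite tV; move: (val _) => v; lia.
Qed.

Lemma torus_count (j : nat) : exists reps : seq 'M[F]_n.+1,
  [/\ (size reps <= (n.+1 * (n.+1 * j) + n.+1 * j).+1 ^ n.+1)%N,
      forall p, p \in reps -> T p
    & forall t, T t -> Gi F val n.+1 j t ->
        exists2 p, p \in reps & maxcpt val T (invmx p *m t)].
Proof.
have [s [s_size hs s1]] := idempotent_decomposition hx (commutant1 x) (mulr1 1).
have sz : (size s <= n.+1)%N by apply: leq_trans s_size (rank_leq_row _).
set M := (n.+1 * (n.+1 * j) + n.+1 * j)%N.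
(* On [G_j] the values shifted by [n.+1 * j] lie between 0 and [M], so [inord] is faithful there.
   Elements with equal index have a quotient of value 0 on every block. *)
pose idx t : {ffun 'I_(size s) -> 'I_M.+1} :=
  [ffun k : 'I_(size s) => inord `|(bval s`_k t + (n.+1 * j)%N%:Z)%R|%N].
pose P b t := [/\ T t, Gi F val n.+1 j t & idx t = b].
have hP b : exists p, T p /\ ((exists t, P b t) -> P b p).
  case: (pselect (exists t, P b t)) => [[t Pt]|nP]; first by exists t; case: (Pt).
  by exists 1%:M; split=> //; exact: (msg1 centralizer_subgroup).
have [r hr] := choice hP.
exists [seq r b | b <- enum {ffun 'I_(size s) -> 'I_M.+1}]; split.
- rewrite size_map -cardE card_ffun !card_ord; exact: leq_pexp2l.
- by move=> p /mapP[b _ ->]; have [] := hr b.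
- move=> t Tt tj; exists (r (idx t)); first by apply: map_f; rewrite mem_enum.
  have [Tr /(_ (ex_intro _ t _))] := hr (idx t); set p := r _ in Tr *.
  case=> [//|_ pj pidx].
  have Tp' := msgV centralizer_subgroup Tr.
  apply: (maxcpt_bval hs s1); first exact: (msgM centralizer_subgroup).
  move=> e es; have he := hs e es; rewrite bvalM// bvalV//.
  have ks : (index e s < size s)%N by rewrite index_mem.
  move/ffunP: pidx => /(_ (Ordinal ks)); rewrite !ffunE /= nth_index//.
  have /andP[a1 a2] := bval_range he Tt tj; have /andP[b1 b2] := bval_range he Tr pj.
  move/(congr1 (@nat_of_ord _)); rewrite !inordK; rewrite /M; lia.
Qed.

End TorusCount.

(** * Measurable subgroups *)

Section TorusSets.
Variables (F : fieldType) (val : F -> int).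
Hypothesis hF : nonarch_local_field val.
Variable n : nat.
Local Notation MTn := (MT val n.+1).
Local Notation mvge := (mvge val).

(** The hypothesis is a Lipschitz condition with loss [a]; it makes the zero set closed. *)
Lemma zero_set_measurable (phi : 'M[F]_n.+1 -> 'M[F]_n.+1) (a : nat) :
  (forall g h k, mball val g k h -> mvge (phi h - phi g) (k - a%:Z)) ->
  measurable ([set g | phi g = 0] : set MTn).
Proof.
move=> H; rewrite -[X in measurable X]setCK; apply: measurableC.
apply: (mopen_measurable hF) => g /= g0.
have [k nk] : exists k : nat, ~ mvge (phi g) k%:Z.
  by apply/existsNP => h; apply: g0; exact: (@mvge_all _ val).
exists (k + a)%N => h /H hh h0; apply: nk.
have -> : phi g = - (phi h - phi g) by rewrite h0 sub0r opprK.
by apply: (mvgeN hF); apply: mvge_le hh; lia.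
Qed.

Lemma centralizer_measurable (x : 'M[F]_n.+1) : measurable (centralizer x : set MTn).
Proof.
have -> : centralizer x = GL F n.+1 `&` [set g | g *m x - x *m g = 0].
  apply/seteqP; split=> g /= [gu gx]; split=> //; first by rewrite gx subrr.
  by apply/eqP; rewrite -subr_eq0; apply/eqP.
apply: measurableI; first exact: (measurable_GL hF).
have [a ha] := mvge_exists val x.
apply: (@zero_set_measurable _ a) => g h k /mballE hh.
have -> : h *m x - x *m h - (g *m x - x *m g) = (h - g) *m x - x *m (h - g).
  by rewrite mulmxBl mulmxBr !opprB [LHS]addrACA [RHS]addrACA [X in _ + X = _]addrC.
by apply: (mvgeB hF); [apply: mvge_le (mvgeM hF hh ha)|apply: mvge_le (mvgeM hF ha hh)]; lia.
Qed.

Lemma Zset_measurable : measurable (Zset F n.+1 : set MTn).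
Proof.
have -> : Zset F n.+1 = GL F n.+1 `&` [set g : 'M[F]_n.+1 | g - (g 0 0)%:M = 0].
  apply/seteqP; split=> [_ [c [c0 ->]]|g [gu /= g0]].
    split; first by rewrite /GL /= unitmx_det0 det_scalar expf_neq0.
    have cE : (c%:M : 'M[F]_n.+1) 0 0 = c by rewrite mxE eqxx mulr1n.
    by rewrite /= cE subrr.
  have gE : g = (g 0 0)%:M by apply/eqP; rewrite -subr_eq0; apply/eqP.
  exists (g 0 0); split=> //; apply/eqP => c0.
  by move: gu; rewrite /GL /= gE c0 unitmx_det0 det_scalar expr0n eqxx.
apply: measurableI; first exact: (measurable_GL hF).
apply: (@zero_set_measurable _ 0) => g h k /mballE hh; rewrite subr0.
have -> : h - (h 0 0)%:M - (g - (g 0 0)%:M) = (h - g) - ((h - g) 0 0)%:M.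
  by apply/matrixP => i j; rewrite !mxE; case: (i == j); rewrite ?mulr1n ?mulr0n; ring.
apply: (mvgeB hF) => // i j; rewrite mxE; case: (i == j); rewrite ?mulr0n ?vge0// mulr1n.
exact: hh.
Qed.

Lemma Zset_subgroup : mx_subgroup (Zset F n.+1).
Proof.
split.
- by move=> _ [c [c0 ->]]; rewrite /GL /= unitmx_det0 det_scalar expf_neq0.
- by exists 1; rewrite oner_eq0.
- move=> _ _ [c [c0 ->]] [d [d0 ->]]; exists (c * d); rewrite mulf_neq0//.
  by rewrite -scalar_mxM.
- by move=> _ [c [c0 ->]]; exists c^-1; rewrite invr_neq0// invmx_scalar.
Qed.

Lemma ZO_GLO : ZO F val n.+1 = Zset F n.+1 `&` GLO F val n.+1.
Proof.
apply/seteqP; split=> [_ [c [c0 [vc ->]]]|_ [[c [c0 ->]] [_ [_]]]].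
  split; first by exists c.
  split; last by rewrite det_scalar expf_neq0// (valX hF)// vc mul0rn.
  move=> i j; rewrite mxE; case: (i == j); rewrite ?mulr0n ?vge0// mulr1n.
  by rewrite vge_val// vc.
rewrite det_scalar (valX hF)// => /eqP; rewrite mulrn_eq0 /= => /eqP vc.
by exists c.
Qed.

Lemma ZO_measurable : measurable (ZO F val n.+1 : set MTn).
Proof.
by rewrite ZO_GLO; apply: measurableI; [exact: Zset_measurable|exact: (GLO_measurable hF)].
Qed.

Lemma ZGi_measurable i : measurable (ZGi F val n.+1 i : set MTn).
Proof.
apply: (mopen_measurable hF); apply: (GL_Gam_open hF) => [g []//|g [gu [c [c0 gi]]]].
exists 1%N => h /(Gam_GLO hF (ltn0Sn 0)) Kh; split.
  by rewrite unitmx_mul gu; exact: GLO_unit Kh.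
exists c; split=> //; rewrite scalemxAl -[i]addn0.
by apply: (GiM hF) => //; exact: GLO_Gi.
Qed.

Section Torus.
Variable x : 'M[F]_n.+1.
Hypothesis hx : Delta x != 0.
Local Notation T := (centralizer x).
Local Notation T0 := (maxcpt val (centralizer x)).

Lemma Zset_centralizer g : Zset F n.+1 g -> T g.
Proof. by move=> [c [c0 ->]]; exact: scalar_centralizer. Qed.

Lemma GLO_maxcpt g : T g -> GLO F val n.+1 g -> T0 g.
Proof.
move=> Tg Kg; split=> //; exists 0 => k.
have H h : GLO F val n.+1 h -> ovG val (mpow h k) <= 0.
  move=> Kh; have /(GLO_Gi)[] // : GLO F val n.+1 (mpow h k).
  by elim: k => [|k IH]; [exact: (GLO1 hF)|rewrite mpowS; exact: (GLOM hF)].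
by split; apply: H => //; exact: (GLOV hF).
Qed.

Lemma maxcptV g : T0 g -> T0 (invmx g).
Proof.
move=> [Tg [C hC]]; split; first exact: (msgV (centralizer_subgroup x)).
by exists C => k; rewrite invmxK; have [] := hC k.
Qed.

Lemma maxcptM g h : T0 g -> T0 h -> T0 (g *m h).
Proof.
move=> [Tg [C hC]] [Th [D hD]]; have gT := centralizer_subgroup x.
split; first exact: (msgM gT).
have H u v (c d : int) k : T u -> T v -> ovG val (mpow u k) <= c ->
    ovG val (mpow v k) <= d -> ovG val (mpow (u *m v) k) <= c + d.
  move=> Tu Tv; rewrite !mpowE => /ovG_le[u1 u2] /ovG_le[v1 v2].
  have -> : (u *m v) ^+ k = u ^+ k * v ^+ k by apply: exprMn_comm; exact: (centralizerC hx).
  have [uu _] := centralizerX k Tu; have [vu _] := centralizerX k Tv.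
  apply/ovG_le; split; first by rewrite opprD; exact: (mvgeM hF).
  by rewrite (val_det_mul hF)//; exact: lerD.
have [gu hu] := (msg_unit gT Tg, msg_unit gT Th).
exists (C + D) => k; have [g1 g2] := hC k; have [h1 h2] := hD k; split; first exact: H.
rewrite invmx_mul// addrC; apply: H => //; exact: (msgV gT).
Qed.

(** [T0] is stable under multiplication by elements of [T] in [Gam 1], hence is the trace on [T] of
    an open set. *)
Lemma maxcpt_measurable : measurable (T0 : set MTn).
Proof.
pose V : set 'M[F]_n.+1 := [set h | exists2 t, T0 t & gcoset val t 1 h].
have -> : T0 = T `&` V.
  apply/seteqP; split=> [t T0t|h [Th [t T0t th]]].
    have Tt : T t by case: T0t.
    split=> //; exists t => //; apply: gcoset_refl; by case: Tt.
  have [Tt _] := T0t; have gT := centralizer_subgroup x.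
  rewrite -[h](mulKVmx (msg_unit gT Tt)); apply: maxcptM => //.
  apply: GLO_maxcpt; last exact: (Gam_GLO hF (ltn0Sn 0)).
  by apply: (msgM gT) => //; exact: (msgV gT).
apply: measurableI; first exact: centralizer_measurable.
apply: (mopen_measurable hF) => h [t T0t th].
have tu : t \in unitmx by case: T0t => -[].
have [k hk] := gcoset_open hF (ltn0Sn 0) tu th.
by exists k => h' /hk ?; exists t.
Qed.

Lemma ZO_maxcpt g : ZO F val n.+1 g -> T0 g.
Proof. by rewrite ZO_GLO => -[/Zset_centralizer Tg Kg]; exact: GLO_maxcpt. Qed.

Lemma maxcpt_haar_sigma_finite (R : realType) (nu : {measure set MTn -> \bar R}) :
  haar_on T T0 nu -> sigma_finite setT nu.
Proof.
move=> hnu.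
apply: (haar_sigma_finite hF (centralizer_subgroup x) (centralizer_measurable x) hnu).
  exact: maxcpt_measurable.
by move=> h Th hh; apply: GLO_maxcpt => //; exact: (Gam_GLO hF (ltn0Sn 0)).
Qed.

Lemma ZO_haar_sigma_finite (R : realType) (nu : {measure set MTn -> \bar R}) :
  haar_on (Zset F n.+1) (ZO F val n.+1) nu -> sigma_finite setT nu.
Proof.
move=> hnu; apply: (haar_sigma_finite hF Zset_subgroup Zset_measurable hnu).
  exact: ZO_measurable.
by move=> h Zh hh; rewrite ZO_GLO; split=> //; exact: (Gam_GLO hF (ltn0Sn 0)).
Qed.

Lemma GLO_haar_sigma_finite (R : realType) (nu : {measure set MTn -> \bar R}) :
  haar_on (GL F n.+1) (GLO F val n.+1) nu -> sigma_finite setT nu.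
Proof.
move=> hnu; apply: (haar_sigma_finite hF (GL_subgroup F n.+1) _ hnu).
- exact: (measurable_GL hF).
- exact: (GLO_measurable hF).
- by move=> h _ hh; exact: (Gam_GLO hF (ltn0Sn 0)).
Qed.

Lemma torus_cover g i : g \in unitmx -> exists reps : seq 'M[F]_n.+1,
  [/\ (size reps <= ((n.+1 * n.+1 + n.+1) * n.+2 * i).+1 ^ n.+1)%N,
      forall p, p \in reps -> T p
    & forall t, T t -> ZGi F val n.+1 i (g *m invmx t) ->
        exists2 p, p \in reps & exists2 z, Zset F n.+1 z & T0 (z *m p *m t)].
Proof.
move=> gu; have gT := centralizer_subgroup x.
case: (pselect (exists2 t, T t & ZGi F val n.+1 i (g *m invmx t))); last first.
  move=> nt; exists [::]; split=> // t Tt gt; case: nt; by exists t.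
move=> [t0 Tt0 [_ [c0 [c00 g0]]]].
(* Inverting an element of [G_i] costs [n.+1 * i], and multiplying by a second one adds [i]. *)
have [reps [szr Tr hr]] := torus_count hF hx (n.+1 * i + i).
(* For [u] a central multiple of [t0 t^-1], the inverse of [p^-1 u] is a central multiple of
   [p t0^-1 t]; this dictates the representatives. *)
exists [seq p *m invmx t0 | p <- reps]; split.
- rewrite size_map; apply: leq_trans szr _; rewrite leq_exp2r// ltnS; nia.
- by move=> _ /mapP[p /Tr Tp ->]; apply: (msgM gT) => //; exact: (msgV gT).
move=> t Tt [_ [c [cn0 gt]]].
have [t0u _] := Tt0; have [tu _] := Tt.
have := GiM hF (GiV hF (ltn0Sn n) g0) gt.
have cc0 : c / c0 != 0 by rewrite mulf_neq0 ?invr_neq0.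
have -> : invmx (c0 *: (g *m invmx t0)) *m (c *: (g *m invmx t)) =
    (c / c0) *: (t0 *m invmx t).
  have [au _] := g0.
  have <- : (c0 *: (g *m invmx t0)) *m ((c / c0) *: (t0 *m invmx t)) = c *: (g *m invmx t).
    rewrite -scalemxAl -scalemxAr scalerA mulrCA divff// mulr1; congr (_ *: _).
    by rewrite mulmxA mulmxKV.
  by rewrite mulKmx.
set u := _ *: _ => uG.
have Tt0t : T (t0 *m invmx t) by apply: (msgM gT) => //; exact: (msgV gT).
have Tu : T u.
  by rewrite /u -mul_scalar_mx; apply: (msgM gT) => //; exact: scalar_centralizer.
have [p pr /maxcptV] := hr u Tu uG.
have Tp := Tr p pr; have [pu _] := Tp; have [uu _] := Tu; have [tt0u _] := Tt0t.
rewrite invmx_mul ?unitmx_inv// invmxK /u invmxZ// invmx_mul ?unitmx_inv// invmxK.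
have Tt0' := msgV gT Tt0.
rewrite -scalemxAl -mulmxA (centralizerC hx Tt); last exact: (msgM gT).
rewrite (centralizerC hx Tt0' Tp) -mul_scalar_mx => H.
exists (p *m invmx t0); first exact: map_f.
exists (c / c0)^-1%:M; first by exists (c / c0)^-1; rewrite invr_neq0.
by rewrite -mulmxA.
Qed.

End Torus.
End TorusSets.

(** * Averages and orbital integrals *)

Section OrbitalIntegral.
Variables (R : realType) (F : fieldType) (val : F -> int).
Hypothesis hF : nonarch_local_field val.
Variable n : nat.
Local Notation MTn := (MT val n.+1).

Lemma measurable_fun_mulmx d (X : measurableType d) (f g : X -> MTn) :
  measurable_fun setT f -> measurable_fun setT g ->
  measurable_fun setT (fun u => (f u *m g u : MTn)).
Proof.
move=> mf mg; exact: (measurableT_comp (measurable_mulmx hF (n := n.+1))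
  (measurable_fun_pair mf mg)).
Qed.

Lemma measurable_fun_invmx d (X : measurableType d) (f : X -> MTn) :
  measurable_fun setT f -> measurable_fun setT (fun u => (invmx (f u) : MTn)).
Proof. by move=> mf; exact: (measurableT_comp (measurable_invmx hF (n := n.+1)) mf). Qed.

Lemma measurable_fun_ind d (X : measurableType d) (A : set MTn) (f : X -> MTn) :
  measurable A -> measurable_fun setT f ->
  measurable_fun setT (fun u => \1_A (f u) : R).
Proof.
move=> mA mf; exact: (measurableT_comp (measurable_indic (D := setT) (R := R) mA) mf).
Qed.

Lemma measurable_locally_constant (f : MTn -> R) :
  (forall g, g \in unitmx -> exists k : nat, forall h, mball val g k%:Z h -> f h = f g) ->
  (forall g, g \notin unitmx -> f g = 0) -> measurable_fun setT f.
Proof.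
move=> fl f0 _ B mB; rewrite setTI.
have -> : f @^-1` B = [set g | g \in unitmx /\ B (f g)] `|`
    (if `[< B 0 >] then ~` GL F n.+1 else set0).
  apply/seteqP; split=> g /=.
    case: (boolP (g \in unitmx)) => gu; first by left.
    by rewrite f0// => B0; right; rewrite asboolT//; exact/negP.
  move=> [[]//|]; case: asboolP => // B0 /negP gu; by rewrite f0.
apply: measurableU; last by case: ifP => // _; apply: measurableC; exact: (measurable_GL hF).
apply: (mopen_measurable hF) => g [gu Bg].
have [k hk] := fl g gu; have [l hl] := @GL_open _ _ hF n.+1 g gu.
exists (maxn k l) => h hh; split; first by apply: hl; apply: mball_le hh; lia.
by rewrite hk//; apply: mball_le hh; lia.
Qed.

Lemma conj_near (g x : 'M[F]_n.+1) (k : int) : g \in unitmx ->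
  exists l : nat, forall h, mball val g l%:Z h -> mball val (conj g x) k (conj h x).
Proof.
move=> gu; have [l1 h1] := mulmx_near hF (g *m x) (invmx g) `|k|.
have [l2 h2] := mulmx_near hF g x l1; have [l3 h3] := invmx_near hF l1 gu.
exists (maxn l2 l3) => h hh; have [hu hV] := h3 h ltac:(apply: mball_le hh; lia).
apply: (@mball_le _ _ _ _ _ `|k|%N%:Z); first by lia.
apply: h1 => //; apply: h2; first by apply: mball_le hh; lia.
exact: mball_refl.
Qed.

Lemma conj_unit (g x : 'M[F]_n.+1) : g \in unitmx -> x \in unitmx -> conj g x \in unitmx.
Proof. by move=> gu xu; rewrite !unitmx_mul gu xu unitmx_inv. Qed.

(** Extension by zero off [GL], where conjugation is meaningless; it gives an integrand measurable
    on the whole matrix space. *)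
Definition conj_fun (f : 'M[F]_n.+1 -> R) (x : 'M[F]_n.+1) (g : MTn) : R :=
  if (g : 'M[F]_n.+1) \in unitmx then f (conj g x) else 0.

Lemma conj_fun_measurable f x : x \in unitmx ->
  (forall g, g \in unitmx -> exists k : int, forall h, mball val g k h -> f h = f g) ->
  measurable_fun setT (conj_fun f x).
Proof.
move=> xu fl; apply: measurable_locally_constant => g gu; last first.
  by rewrite /conj_fun (negPf gu).
have [k hk] := fl _ (conj_unit gu xu).
have [l hl] := conj_near x k gu; have [l' hl'] := @GL_open _ _ hF n.+1 g gu.
exists (maxn l l') => h hh; rewrite /conj_fun gu.
have -> : h \in unitmx by apply: hl'; apply: mball_le hh; lia.
by apply: hk; apply: hl; apply: mball_le hh; lia.
Qed.

Section Torus.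
Variable x : 'M[F]_n.+1.
Hypothesis hx : Delta x != 0.
Local Notation T := (centralizer x).
Local Notation T0 := (maxcpt val (centralizer x)).
Variables (nuZ nux : {measure set MTn -> \bar R}) (wZ : MTn -> R).
Hypotheses (hnuZ : haar_on (Zset F n.+1) (ZO F val n.+1) nuZ)
  (hwZ : qweight (Zset F n.+1) nuZ wZ) (hnux : haar_on T T0 nux).

Let mT := centralizer_measurable hF x.
Let mT0 := maxcpt_measurable hF hx.
Let mZ := @Zset_measurable _ _ hF n.
Let gT := centralizer_subgroup x.
Let sx := maxcpt_haar_sigma_finite hF hx hnux.
Let sZ := ZO_haar_sigma_finite hF hnuZ.
Let wZ0 g : 0 <= wZ g. Proof. by case: hwZ. Qed.
Let mwZ : measurable_fun setT wZ. Proof. by case: hwZ. Qed.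

(** The coset of [Z T0] through [p^-1] has mass 1 in [T/Z]: for [t] in it the admissible [z] fill
    one coset of [ZO]. The left translation [s = z p t] turns the weight into one evaluated at
    [g s^-1 p z], which integrates to 1 over [Z], and [T0] has measure 1. *)
Lemma ZT0_integral g p : g \in unitmx -> T p ->
  (\int[nux]_t \int[nuZ]_z (\1_T0 (z *m p *m t : MTn) * wZ (g *m invmx t : MTn))%:E = 1)%E.
Proof.
move=> gu Tp; have [Zc _ ZO1] := hnuZ; have [Tc _ T01] := hnux.
pose f (u : MTn * MTn) : \bar R :=
  (\1_T0 (u.2 *m p *m u.1 : MTn) * wZ (g *m invmx u.1 : MTn))%:E.
have f0 u : (0 <= f u)%E by rewrite lee_fin mulr_ge0.
have m1 : measurable_fun setT (fst : MTn * MTn -> MTn) := measurable_fst.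
have m2 : measurable_fun setT (snd : MTn * MTn -> MTn) := measurable_snd.
have mf : measurable_fun setT f.
  apply/measurable_EFinP; apply: measurable_funM.
    apply: measurable_fun_ind => //; apply: measurable_fun_mulmx => //.
    by apply: measurable_fun_mulmx => //; exact: measurable_cst.
  apply: (measurableT_comp mwZ); apply: measurable_fun_mulmx; first exact: measurable_cst.
  exact: measurable_fun_invmx.
rewrite (tonelli (f := f) sx sZ mf f0).
pose h (u : MTn * MTn) : \bar R :=
  (\1_T0 (u.2 : MTn) * wZ (g *m (invmx u.2 *m p) *m u.1 : MTn))%:E.
have h0 u : (0 <= h u)%E by rewrite lee_fin mulr_ge0.
have mh : measurable_fun setT h.
  apply/measurable_EFinP; apply: measurable_funM; first exact: measurable_fun_ind.
  apply: (measurableT_comp mwZ); apply: measurable_fun_mulmx => //.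
  apply: measurable_fun_mulmx; first exact: measurable_cst.
  by apply: measurable_fun_mulmx; [exact: measurable_fun_invmx|exact: measurable_cst].
transitivity (\int[nuZ]_z \int[nux]_s h (z, s))%E.
  rewrite -(ge0_integral_conull mZ Zc); last 2 first.
  - exact: measurable_fun_tonelli2.
  - by move=> z; apply: integral_ge0.
  rewrite -[RHS](ge0_integral_conull mZ Zc); last 2 first.
  - exact: measurable_fun_tonelli.
  - by move=> z; apply: integral_ge0.
  apply: eq_integral => z; rewrite inE => Zz.
  have Tzp : T (z *m p) by apply: (msgM gT) => //; exact: Zset_centralizer.
  have zpu := msg_unit gT Tzp.
  pose k (s : MTn) : \bar R :=
    (\1_T0 s * wZ (g *m invmx (invmx (z *m p) *m s) : MTn))%:E.
  transitivity (\int[nux]_t k (z *m p *m t))%E.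
    by apply: eq_integral => t _; rewrite /k /f /= mulKmx.
  rewrite (ge0_integral_invariant (f := k)).
  - apply: eq_integral => s _; rewrite /k /h /= !indicE; congr (_%:E).
    case: (boolP (s \in _)) => sT; last by rewrite !mul0r.
    have [Ts _] : T0 s by rewrite inE in sT.
    have [su _] := Ts; rewrite (invmx_mul (g := invmx (z *m p)) (h := s)) ?unitmx_inv// invmxK.
    rewrite (centralizerC hx (Zset_centralizer x Zz) Tp).
    by rewrite !mulmxA.
  - exact: (measurable_mulmxl hF).
  - by move=> A mA; apply: (haar_left_invariant hF gT mT hnux).
  - apply/measurable_EFinP; apply: measurable_funM; first exact: measurable_indic.
    apply: (measurableT_comp mwZ); apply: measurable_fun_mulmx; first exact: measurable_cst.
    by apply: measurable_fun_invmx; exact: (measurable_mulmxl hF).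
  - by move=> s; rewrite lee_fin mulr_ge0.
rewrite (tonelli (f := h) sZ sx mh h0).
transitivity (\int[nux]_s (\1_T0 s)%:E)%E; last first.
  by rewrite integral_indic// setIT.
apply: eq_integral => s _; rewrite /h /=; rewrite indicE.
case: (boolP (s \in _)) => sT; last first.
  by apply: integral0_eq => z _; rewrite mul0r.
have [Ts _] : T0 s by rewrite inE in sT.
have [su _] := Ts; have [pu _] := Tp.
have [_ _ /(_ (g *m (invmx s *m p))) E] := hwZ.
under eq_integral do rewrite mul1r.
rewrite -(ge0_integral_conull mZ Zc) ?E//.
- by rewrite !unitmx_mul gu unitmx_inv su.
- apply/measurable_EFinP; apply: (measurableT_comp mwZ); exact: (measurable_mulmxl hF).
- by move=> z; rewrite lee_fin.
Qed.

(** The count of [torus_count] at level [j = n.+2 * i]. *)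
Definition coset_bound (i : nat) := (((n.+1 * n.+1 + n.+1) * n.+2 * i).+1 ^ n.+1)%N.

(** The translate of [ZO] by [z0] has mass 1, and each [z] in it keeps [z p t] in [T0]. *)
Lemma ZT0_integral_ge p t (w : R) z0 : 0 <= w -> T p -> T t -> Zset F n.+1 z0 ->
  T0 (z0 *m p *m t) -> (w%:E <= \int[nuZ]_z (\1_T0 (z *m p *m t : MTn) * w)%:E)%E.
Proof.
move=> w0 Tp Tt Zz0 H; have [_ _ ZO1] := hnuZ; have mZO := @ZO_measurable _ _ hF n.
have gZ := @Zset_subgroup F n; have z0u := msg_unit gZ Zz0; have Zz0' := msgV gZ Zz0.
pose S : set MTn := (fun z : MTn => (invmx z0 *m z : MTn)) @^-1` ZO F val n.+1.
have mS : measurable S by exact: measurable_preimage_mulmxl.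
have -> : w%:E = (\int[nuZ]_z (\1_S z * w)%:E)%E.
  under eq_integral do rewrite EFinM.
  rewrite ge0_integralZr//; last by apply/measurable_EFinP; exact: measurable_indic.
  rewrite integral_indic// setIT (haar_left_invariant hF gZ mZ hnuZ Zz0' mZO) ZO1.
  by rewrite mul1e.
apply: ge0_le_integral => //.
- by move=> z _; rewrite lee_fin mulr_ge0.
- apply/measurable_EFinP; apply: measurable_funM; last exact: measurable_cst.
  exact: measurable_indic.
- apply/measurable_EFinP; apply: measurable_funM; last exact: measurable_cst.
  apply: measurable_fun_ind => //; apply: measurable_fun_mulmx; last exact: measurable_cst.
  exact: (measurable_mulmxr hF).
- move=> z _; rewrite lee_fin; apply: ler_wpM2r => //; rewrite !indicE.
  case: (boolP (z \in S)) => // zS.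
  have {}zS : ZO F val n.+1 (invmx z0 *m z) by rewrite inE in zS.
  have -> : z *m p *m t = (invmx z0 *m z) *m (z0 *m p *m t).
    have Tz0 := Zset_centralizer x Zz0.
    have /(Zset_centralizer x) Tz : Zset F n.+1 (invmx z0 *m z).
      by move: zS; rewrite (ZO_GLO hF) => -[].
    by rewrite -!mulmxA (mulmxA z0) !mulmxA -(mulmxA (invmx z0 *m z) z0)
       ?mulmxA (centralizerC hx Tz Tz0) mulKVmx.
  by rewrite mem_set//; apply: (maxcptM hF hx) => //; exact: (ZO_maxcpt hF).
Qed.

(** The left side is a mass in [T/Z]. Covering by the cosets of [torus_cover] majorises the
    indicator by a sum of integrals over [Z], and each term then integrates to 1 over [T]. *)
Lemma ZGi_torus_integral g i : g \in unitmx ->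
  (\int[nux]_t (\1_T t * (\1_(ZGi F val n.+1 i) (g *m invmx t : MTn) *
     wZ (g *m invmx t : MTn)))%:E <= (coset_bound i)%:R%:E)%E.
Proof.
move=> gu; have [reps [szr Tr hr]] := torus_cover hF hx i gu.
have mG := @ZGi_measurable _ _ hF n i.
have mgV : measurable_fun setT (fun t : MTn => (g *m invmx t : MTn)).
  by apply: measurable_fun_mulmx; [exact: measurable_cst|exact: measurable_fun_invmx].
pose f p (u : MTn * MTn) : \bar R :=
  (\1_T0 (u.2 *m p *m u.1 : MTn) * wZ (g *m invmx u.1 : MTn))%:E.
have f0 p u : (0 <= f p u)%E by rewrite lee_fin mulr_ge0.
have m1 : measurable_fun setT (fst : MTn * MTn -> MTn) := measurable_fst.
have m2 : measurable_fun setT (snd : MTn * MTn -> MTn) := measurable_snd.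
have mf p : measurable_fun setT (f p).
  apply/measurable_EFinP; apply: measurable_funM.
    apply: measurable_fun_ind => //; apply: measurable_fun_mulmx => //.
    by apply: measurable_fun_mulmx => //; exact: measurable_cst.
  apply: (measurableT_comp mwZ); apply: measurable_fun_mulmx; first exact: measurable_cst.
  exact: measurable_fun_invmx.
have mF p : measurable_fun setT (fun t => \int[nuZ]_z f p (t, z))%E.
  exact: measurable_fun_tonelli.
have F0 p t : (0 <= \int[nuZ]_z f p (t, z))%E by apply: integral_ge0.
apply: (@le_trans _ _ (\int[nux]_t \sum_(p <- reps) \int[nuZ]_z f p (t, z))%E).
  apply: ge0_le_integral => //.
  - by move=> t _; rewrite lee_fin !mulr_ge0.
  - apply/measurable_EFinP; apply: measurable_funM; first exact: measurable_indic.
    by apply: measurable_funM; [exact: measurable_fun_ind|exact: (measurableT_comp mwZ)].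
  - exact: emeasurable_sum.
  - move=> t _; have s0 : (0 <= \sum_(p <- reps) \int[nuZ]_z f p (t, z))%E.
      by apply: sume_ge0 => p _.
    rewrite !indicE.
    case: (boolP (t \in T)) => [tT|_]; last by rewrite mul0r.
    case: (boolP ((g *m invmx t : MTn) \in _)) => [tG|_]; last by rewrite mul0r mulr0.
    have Tt : T t by rewrite inE in tT.
    have [p pr [z0 Zz0 H]] := hr t Tt ltac:(by rewrite inE in tG).
    rewrite !mul1r (big_rem p)//=; apply: (@le_trans _ _ (\int[nuZ]_z f p (t, z))%E).
      exact: (ZT0_integral_ge (wZ0 _) (Tr p pr) Tt Zz0 H).
    by apply: leeDl; apply: sume_ge0 => q _.
rewrite ge0_integral_sum//.
rewrite (eq_big_seq (fun=> 1%E)); last by move=> p pr; apply: ZT0_integral => //; exact: Tr.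
by rewrite sume_const// mule1 lee_fin ler_nat.
Qed.

Lemma average_bound (mu : {measure set MTn -> \bar R}) (wx : MTn -> R)
  (f : 'M[F]_n.+1 -> R) i :
  haar_on (GL F n.+1) (GLO F val n.+1) mu -> qweight T nux wx ->
  (forall g, 0 <= f g) -> measurable_fun setT (conj_fun f x) ->
  (\int[mu]_g (\1_(ZGi F val n.+1 i) g * conj_fun f x g * wZ g)%:E <=
   (coset_bound i)%:R%:E * \int[mu]_g (conj_fun f x g * wx g)%:E)%E.
Proof.
move=> hmu [wx0 mwx wx1] f0 mphi.
have smu := GLO_haar_sigma_finite hF hmu; have [Tc _ _] := hnux.
have mG := @ZGi_measurable _ _ hF n i.
have phi0 g : 0 <= conj_fun f x g by rewrite /conj_fun; case: ifP.
pose a (g : MTn) : R := \1_(ZGi F val n.+1 i) g * conj_fun f x g * wZ g.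
have a0 g : 0 <= a g by rewrite !mulr_ge0.
have ma : measurable_fun setT a.
  apply: measurable_funM => //; apply: measurable_funM => //; exact: measurable_indic.
have m1 : measurable_fun setT (fst : MTn * MTn -> MTn) := measurable_fst.
have m2 : measurable_fun setT (snd : MTn * MTn -> MTn) := measurable_snd.
pose h1 (u : MTn * MTn) : \bar R := (a u.1 * wx (u.1 *m u.2 : MTn))%:E.
have h10 u : (0 <= h1 u)%E by rewrite lee_fin mulr_ge0.
have mh1 : measurable_fun setT h1.
  apply/measurable_EFinP; apply: measurable_funM; first exact: (measurableT_comp ma).
  by apply: (measurableT_comp mwx); exact: measurable_fun_mulmx.
pose h2 (u : MTn * MTn) : \bar R :=
  (\1_T u.2 * (a (u.1 *m invmx u.2 : MTn) * wx u.1))%:E.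
have h20 u : (0 <= h2 u)%E by rewrite lee_fin !mulr_ge0.
have mh2 : measurable_fun setT h2.
  apply/measurable_EFinP; apply: measurable_funM; first exact: measurable_fun_ind.
  apply: measurable_funM; last exact: (measurableT_comp mwx).
  apply: (measurableT_comp ma); apply: measurable_fun_mulmx => //.
  exact: measurable_fun_invmx.
have -> : (\int[mu]_g (a g)%:E = \int[mu]_g \int[nux]_t h1 (g, t))%E.
  apply: eq_integral => g _; rewrite /h1 /=.
  (* The weight identity is available at invertible [g] only; elsewhere the integrand vanishes. *)
  have [gu|gu] := boolP ((g : 'M[F]_n.+1) \in unitmx); last first.
    have -> : a g = 0 by rewrite /a /conj_fun (negPf gu) mulr0 mul0r.
    by apply/esym/integral0_eq => t _; rewrite mul0r.
  under eq_integral do rewrite EFinM.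
  have mwg : measurable_fun setT (fun t : MTn => (wx (g *m t : MTn))%:E).
    by apply/measurable_EFinP; apply: (measurableT_comp mwx); exact: (measurable_mulmxl hF).
  rewrite (ge0_integralZl nux measurableT mwg);
    [|by move=> t _; rewrite lee_fin|by rewrite lee_fin].
  rewrite -(ge0_integral_conull mT Tc)//; last by move=> t; rewrite lee_fin.
  by rewrite wx1// mule1.
rewrite (tonelli (f := h1) smu sx mh1 h10).
have -> : (\int[nux]_t \int[mu]_g h1 (g, t) = \int[nux]_t \int[mu]_g h2 (g, t))%E.
  rewrite -(ge0_integral_conull mT Tc); last 2 first.
  - exact: measurable_fun_tonelli2.
  - by move=> t; apply: integral_ge0.
  rewrite -[RHS](ge0_integral_conull mT Tc); last 2 first.
  - exact: measurable_fun_tonelli2.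
  - by move=> t; apply: integral_ge0.
  apply: eq_integral => t tT; have Tt : T t by rewrite inE in tT.
  have [tu _] := Tt.
  pose k (s : MTn) : \bar R := (a (s *m invmx t : MTn) * wx s)%:E.
  transitivity (\int[mu]_g k (g *m t))%E.
    by apply: eq_integral => g _; rewrite /k /h1 /= mulmxK.
  rewrite (ge0_integral_invariant (f := k)).
  - by apply: eq_integral => g _; rewrite /k /h2 /= indicE tT mul1r.
  - exact: (measurable_mulmxr hF).
  - by move=> A mA; apply: (haar_right_invariant hF hmu).
  - apply/measurable_EFinP; apply: measurable_funM => //.
    by apply: (measurableT_comp ma); exact: (measurable_mulmxr hF).
  - by move=> s; rewrite lee_fin mulr_ge0.
rewrite -(tonelli (f := h2) smu sx mh2 h20).
have mpw : measurable_fun setT (fun g : MTn => (conj_fun f x g * wx g)%:E).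
  by apply/measurable_EFinP; exact: measurable_funM.
rewrite -(ge0_integralZl mu measurableT mpw);
  [|by move=> g _; rewrite lee_fin mulr_ge0|by rewrite lee_fin].
apply: ge0_le_integral => //.
- by move=> g _; apply: integral_ge0.
- exact: measurable_fun_tonelli.
- by apply: emeasurable_funM => //; exact: measurable_cst.
move=> g _; rewrite /h2 /=.
have [gu|gu] := boolP ((g : 'M[F]_n.+1) \in unitmx); last first.
  rewrite [conj_fun f x g]/conj_fun (negPf gu) mul0r mule0.
  rewrite integral0_eq// => t _; rewrite indicE.
  case: (boolP (t \in T)) => [tT|_]; last by rewrite mul0r.
  by rewrite /a /conj_fun unitmx_mul (negPf gu) /= mulr0 !mul0r mulr0.
have mgV : measurable_fun setT (fun t : MTn => (g *m invmx t : MTn)).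
  by apply: measurable_fun_mulmx; [exact: measurable_cst|exact: measurable_fun_invmx].
rewrite [X in (X <= _)%E](_ : _ = (\int[nux]_t ((conj_fun f x g * wx g)%:E *
   (\1_T t * (\1_(ZGi F val n.+1 i) (g *m invmx t : MTn) * wZ (g *m invmx t : MTn)))%:E))%E).
  rewrite ge0_integralZl//.
  - rewrite muleC; apply: lee_wpmul2r; first by rewrite lee_fin mulr_ge0.
    exact: ZGi_torus_integral.
  - apply/measurable_EFinP; apply: measurable_funM; first exact: measurable_indic.
    by apply: measurable_funM; [exact: measurable_fun_ind|exact: (measurableT_comp mwZ)].
  - by move=> t _; rewrite lee_fin !mulr_ge0.
  - by rewrite lee_fin mulr_ge0.
apply: eq_integral => t _; rewrite -EFinM; congr (_%:E); rewrite !indicE.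
case: (boolP (t \in T)) => [tT|_]; last by rewrite !mul0r mulr0.
have [tu tx] : T t by rewrite inE in tT.
(* The torus commutes with [x], so [g t^-1] and [g] conjugate [x] to the same matrix and the test
   function leaves the torus integral. *)
have -> : a (g *m invmx t) = \1_(ZGi F val n.+1 i) (g *m invmx t : MTn) *
    conj_fun f x g * wZ (g *m invmx t).
  rewrite /a; congr (_ * _ * _); rewrite /conj_fun unitmx_mul gu unitmx_inv tu /=.
  congr f; rewrite /conj invmx_mul ?unitmx_inv// invmxK -!mulmxA; congr (_ *m _).
  by rewrite !mulmxA -[invmx t *m x *m t]mulmxA -tx mulKmx.
by rewrite indicE; ring.
Qed.

End Torus.
End OrbitalIntegral.

(** * Complex test functions and the final estimate *)

Lemma cnorm_le_normD (R : realType) (z : R * R) : cnorm z <= `|z.1| + `|z.2|.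
Proof.
have h : 0 <= `|z.1| + `|z.2| by rewrite addr_ge0.
rewrite -[leRHS]ger0_norm// -sqrtr_sqr; apply: ler_wsqrtr.
rewrite sqrrD !real_normK ?num_real// lerD2r lerDl.
by rewrite mulrn_wge0// mulr_ge0.
Qed.

Lemma normr1_le_cnorm (R : realType) (z : R * R) : `|z.1| <= cnorm z.
Proof. by rewrite -sqrtr_sqr; apply: ler_wsqrtr; rewrite lerDl sqr_ge0. Qed.

Lemma normr2_le_cnorm (R : realType) (z : R * R) : `|z.2| <= cnorm z.
Proof. by rewrite -sqrtr_sqr; apply: ler_wsqrtr; rewrite lerDr sqr_ge0. Qed.

Lemma norm_average_le (R : realType) (F : fieldType) (val : F -> int)
  (hF : nonarch_local_field val) (n : nat) (mu : {measure set (MT val n.+1) -> \bar R})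
  (wZ : MT val n.+1 -> R) (r f : 'M[F]_n.+1 -> R) (x : 'M[F]_n.+1) i :
  (forall g, 0 <= wZ g) -> measurable_fun setT wZ ->
  measurable_fun setT (conj_fun r x : MT val n.+1 -> R) ->
  measurable_fun setT (conj_fun f x : MT val n.+1 -> R) ->
  (forall g, `|r g| <= f g) ->
  ((`|\int[mu]_(g in (ZGi F val n.+1 i : set (MT val n.+1))) (r (conj g x) * wZ g)|)%:E <=
   \int[mu]_g (\1_(ZGi F val n.+1 i) g * conj_fun f x g * wZ g)%:E)%E.
Proof.
move=> wZ0 mwZ mr mf rf; have mG := @ZGi_measurable _ _ hF n i.
have sub (A : set (MT val n.+1)) (h : MT val n.+1 -> R) :
    measurable_fun setT h -> measurable_fun A h.
  by move=> mh; exact: measurable_funS mh.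
(* [Rintegral] is [fine] of an extended integral, hence 0 when that is infinite; the inequality
   survives this default. *)
have le_fine (e : \bar R) : ((`|fine e|)%:E <= `|e|)%E.
  by case: e => [v| |] //=; rewrite normr0 leey.
have mrw : measurable_fun setT (fun g : MT val n.+1 => conj_fun r x g * wZ g).
  exact: measurable_funM.
have mfw : measurable_fun setT (fun g : MT val n.+1 => conj_fun f x g * wZ g).
  exact: measurable_funM.
rewrite /Rintegral; apply: le_trans (le_fine _) _.
rewrite (@eq_integral _ _ _ _ _ (fun g => (conj_fun r x g * wZ g)%:E)); last first.
  by move=> g; rewrite inE => -[gu _]; rewrite /conj_fun gu.
apply: le_trans (le_abse_integral _ mG _) _.
  by apply/measurable_EFinP; apply: sub.
apply: (@le_trans _ _ (\int[mu]_(g in (ZGi F val n.+1 i : set (MT val n.+1)))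
    (conj_fun f x g * wZ g)%:E)%E).
  apply: ge0_le_integral => //.
  - apply: measurableT_comp => //.
    by apply/measurable_EFinP; apply: sub.
  - by apply/measurable_EFinP; apply: sub.
  - move=> g [gu _]; rewrite abse_EFin lee_fin normrM [`|wZ g|]ger0_norm//.
    by apply: ler_wpM2r => //; rewrite /conj_fun gu.
rewrite integral_mkcond le_eqVlt; apply/orP; left; apply/eqP.
apply: eq_integral => g _; rewrite /patch indicE.
by case: (_ \in _); rewrite ?mul1r ?mul0r.
Qed.

Theorem theoremD (R : realType) (F : fieldType) (val : F -> int)
  (hF : nonarch_local_field val) (n : nat) (hn : (0 < n)%N)
  (mu : {measure set (MT val n) -> \bar R})
  (hmu : haar_on (GL F n) (GLO F val n) mu) :
  exists alpha : {poly int}, (forall k, 0 <= alpha`_k) /\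
  forall (mr mi : 'M[F]_n -> R), smooth_cpt_mod_center val mr mi ->
  forall x : 'M[F]_n, Grss F n x ->
  forall i : nat,
  forall (nuZ : {measure set (MT val n) -> \bar R}),
    haar_on (Zset F n) (ZO F val n) nuZ ->
  forall wZ : MT val n -> R, qweight (Zset F n) nuZ wZ ->
  forall (nux : {measure set (MT val n) -> \bar R}),
    haar_on (centralizer x) (maxcpt val (centralizer x)) nux ->
  forall wx : MT val n -> R, qweight (centralizer x) nux wx ->
  ((cnorm (Avg mu wZ mr mi i x))%:E <=
     ((alpha.[i%:Z + ovGrss val x])%:~R)%:E
       * Orb mu wx (fun g => cnorm (mr g, mi g)) x)%E.
Proof.
case: n hn mu hmu => [//|n] _ mu hmu.
(* [C] and the exponent are those of [coset_bound]; the factor 2 pays for bounding real and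
   imaginary parts separately. *)
pose C := ((n.+1 * n.+1 + n.+1) * n.+2)%N.
exists (2%:Z *: (C%:Z *: 'X + 1) ^+ n.+1); split.
  move=> k; suff /polyOverP/(_ k) :
    2%:Z *: (C%:Z *: 'X + 1) ^+ n.+1 \is a polyOver (Num.nneg : {pred int}) by [].
  apply: polyOverZ => //; apply: rpredX; apply: rpredD; last exact: rpred1.
  by apply: polyOverZ => //; exact: polyOverX.
move=> mr mi [mloc _] x [xu hx] i nuZ hnuZ wZ hwZ nux hnux wx hwx.
have [wZ0 mwZ _] := hwZ; have [wx0 mwx _] := hwx.
pose f g : R := cnorm (mr g, mi g).
have f0 g : 0 <= f g by exact: sqrtr_ge0.
have mphi : measurable_fun setT (conj_fun f x : MT val n.+1 -> R).
  apply: (conj_fun_measurable hF xu) => g /mloc [k hk]; exists k => h /hk [].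
  by rewrite /f => -> ->.
have mphir : measurable_fun setT (conj_fun mr x : MT val n.+1 -> R).
  by apply: (conj_fun_measurable hF xu) => g /mloc [k hk]; exists k => h /hk [].
have mphii : measurable_fun setT (conj_fun mi x : MT val n.+1 -> R).
  by apply: (conj_fun_measurable hF xu) => g /mloc [k hk]; exists k => h /hk [].
have hr := norm_average_le hF mu i wZ0 mwZ mphir mphi (fun g => normr1_le_cnorm (mr g, mi g)).
have hi := norm_average_le hF mu i wZ0 mwZ mphii mphi (fun g => normr2_le_cnorm (mr g, mi g)).
have hb := average_bound hF hx hnuZ hwZ hnux i hmu hwx f0 mphi.
have -> : Orb mu wx f x = (\int[mu]_g (conj_fun f x g * wx g)%:E)%E.
  rewrite /Orb integral_mkcond; apply: eq_integral => g _; rewrite /patch /conj_fun mem_setE.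
  by case: ifP => // _; rewrite mul0r.
set I2 := (\int[mu]_g (conj_fun f x g * wx g)%:E)%E in hb *.
have I20 : (0 <= I2)%E.
  apply: integral_ge0 => g _; rewrite lee_fin mulr_ge0//.
  by rewrite /conj_fun; case: ifP.
apply: (@le_trans _ _ ((2 * (coset_bound n i)%:R)%:E * I2)%E).
  apply: (@le_trans _ _ (`|(Avg mu wZ mr mi i x).1|%:E + `|(Avg mu wZ mr mi i x).2|%:E)%E).
    by rewrite -EFinD lee_fin; exact: cnorm_le_normD.
  rewrite EFinM -muleA mule_natl mule2n.
  by apply: leeD; [apply: le_trans hr hb|apply: le_trans hi hb].
apply: lee_wpmul2r => //; rewrite lee_fin.
(* [ovG] is nonnegative on [GL], so monotonicity of the polynomial allows [i] to be replaced by the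
   larger argument. *)
have iy : i%:Z <= i%:Z + ovGrss val x.
  by rewrite lerDl le_max (ovG_ge0 hF xu).
move: (i%:Z + ovGrss val x) iy => y iy.
have -> : 2 * (coset_bound n i)%:R = (2%:Z * (C%:Z * i%:Z + 1) ^+ n.+1)%:~R :> R.
  rewrite rmorphM rmorphXn rmorphD rmorphM rmorph1 /= -!pmulrn -!natrM natr1 -natrX -natrM.
  by rewrite /coset_bound /C.
rewrite ler_int hornerZ horner_exp hornerD hornerZ hornerX -polyC1 hornerC.
rewrite ler_wpM2l// lerXn2r ?nnegrE//; nia.
Qed.
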